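(* Let $1\le r\le\infty$ and $m\ge 1$. There is a constant $C(m,r)\ge 1$ with $$C(m,r)\le \begin{cases} e\,m\,e^{(m-1)/r} & \text{if } 1\le r\le 2,\\ e\,m\,2^{(m-1)/2} & \text{if } 2\le r\le\infty,\end{cases}$$ such that for every $n\ge 1$, every $P\in\mathcal P(^{\mathcal J(m,n)}\ell_r)$, every $J\subset\mathcal J(m,n)$ and every $u\in\ell_r$, $$\sum_{\mathbf j\in J}|c_{\mathbf j}(P)|\,|u_{\mathbf j}|\le C(m,r)\,|J^*|^{1-\frac1{\min(r,2)}}\,\|u\|_r^m\,\|P\|_\infty .$$ In particular, for every finite $J\subset\mathcal J(m)$, $$\chi_{\mathrm{mon}}\big(\mathcal P(^J\ell_r)\big)\le C(m,r)\,|J^*|^{1-\frac1{\min(r,2)}} .$$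
   Context: All spaces are complex. $\mathcal J(m,n)=\{\mathbf j=(j_1,\dots,j_m)\in\mathbb N^m: 1\le j_1\le\dots\le j_m\le n\}$ and $\mathcal J(m)=\bigcup_n\mathcal J(m,n)$. For $\mathbf j=(j_1,\dots,j_m)$ and a sequence $u$, $u_{\mathbf j}=u_{j_1}\cdots u_{j_m}$, and $z_{\mathbf j}$ denotes the monomial $u\mapsto u_{\mathbf j}$. For finite $J\subset\mathcal J(m)$, $\mathcal P(^J\ell_r)=\mathrm{span}\{z_{\mathbf j}:\mathbf j\in J\}$, a space of $m$-homogeneous polynomials on $\ell_r$ with norm $\|P\|_\infty=\sup_{\|u\|_r<1}|P(u)|$; $c_{\mathbf j}(P)$ is the coefficient of $z_{\mathbf j}$ in $P$. The reduced set of $J\subset \mathcal J(m)$ is $J^*=\{\mathbf j\in\mathcal J(m-1): \exists k\ge1,\ (\mathbf j,k)\in J\}$, where $(\mathbf j,k)=(j_1,\dots,j_{m-1},k)$; for $m=1$, $\mathcal J(0)$ consists of the empty index only. $|A|$ is the cardinality of the set $A$. $\chi_{\mathrm{mon}}(\mathcal P(^J\ell_r))$ is the unconditional basis constant of the monomials $(z_{\mathbf j})_{\mathbf j\in J}$: the least $c\ge0$ with $\|\sum_{\mathbf j\in J}\varepsilon_{\mathbf j}c_{\mathbf j}z_{\mathbf j}\|_\infty\le c\,\|\sum_{\mathbf j\in J}c_{\mathbf j}z_{\mathbf j}\|_\infty$ for all scalars $c_{\mathbf j}$ and all $\varepsilon_{\mathbf j}\in\mathbb C$ with $|\varepsilon_{\mathbf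 j}|=1$. *)

(* Defs.v *)
From HB Require Import structures.
From mathcomp Require Import all_boot all_order all_algebra finmap.
From mathcomp Require Import complex.
From mathcomp Require Import all_classical all_reals all_analysis.

Set Implicit Arguments.
Unset Strict Implicit.
Unset Printing Implicit Defensive.

Import Order.TTheory GRing.Theory Num.Theory.
Import ComplexField.Normc.

Local Open Scope classical_set_scope.
Local Open Scope ring_scope.

(* Sequences and index tuples are numbered from 0, so the indices 1, ..., n of
   the usual convention become 0, ..., n - 1. *)

Definition Jidx (m : nat) : set (seq nat) :=
  [set j | size j = m /\ sorted leq j].

Definition Jidx_le (m n : nat) : set (seq nat) :=
  [set j | Jidx m j /\ all (fun k => (k < n)%N) j].

(* J^*, for J a set of indices of length m >= 1. *)
Definition reduced (m : nat) (J : set (seq nat)) : set (seq nat) :=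
  [set j | Jidx m.-1 j /\ exists k, J (rcons j k)].

(* [fset_set] of an infinite set is empty; reduced sets of finite sets are
   finite, see [finite_reduced]. *)
Definition set_card (A : set (seq nat)) : nat := #|` fset_set A|%fset.

Section Polynomials.
Variable R : realType.
Implicit Types (r : \bar R) (u : nat -> R[i]) (J : set (seq nat))
  (c eps : seq nat -> R[i]) (P : (nat -> R[i]) -> R[i]).

Definition lnorm r u : \bar R := Lnorm counting r (fun k => (normc (u k))%:E).

Definition ell r : set (nat -> R[i]) := [set u | (lnorm r u < +oo)%E].

Definition monomial (j : seq nat) u : R[i] := \prod_(k <- j) u k.

Definition hpoly J c u : R[i] := \sum_(j \in J) c j * monomial j u.

(* P, as a function on ell_r, is the element of span {z_j : j in J} with
   coefficients c_j(P) = c j for j in J. *)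
Definition has_coefs r J P c : Prop := {in ell r, P =1 hpoly J c}.

Definition supnorm r P : \bar R :=
  ereal_sup [set (normc (P u))%:E | u in [set u | (lnorm r u < 1)%E]].

Definition is_uncond_bound r J (b : R) : Prop :=
  0 <= b /\
  forall c eps, (forall j, J j -> normc (eps j) = 1) ->
    (supnorm r (hpoly J (fun j => (eps j * c j)%R))
       <= b%:E * supnorm r (hpoly J c))%E.

Definition chi_mon r J : \bar R := ereal_inf [set b%:E | b in is_uncond_bound r J].

(* 1 - 1 / min(r, 2); the minimum is a real number for every r in [1, +oo]. *)
Definition red_exponent r : R := 1 - (fine (Order.min r 2%:E))^-1.

End Polynomials.

Lemma finite_Jidx_le (m n : nat) : finite_set (Jidx_le m n).
Proof.
apply: (@sub_finite_set _ _ [set map val (t : seq 'I_n) | t in [set: m.-tuple 'I_n]]).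
  move=> j [[sj _] /allP jn] /=.
  have E : map val (pmap insub j : seq 'I_n) = j.
    rewrite pmap_filter; first by apply/all_filterP/allP => k /jn kn; rewrite insubT.
    exact: insubK.
  have st : size (pmap insub j : seq 'I_n) == m by rewrite -(size_map val) E sj.
  by exists (Tuple st).
exact: finite_image.
Qed.

Lemma finite_reduced (m : nat) (J : set (seq nat)) :
  finite_set J -> finite_set (reduced m J).
Proof.
move=> fJ; apply: (@sub_finite_set _ _ [set take m.-1 j | j in J]).
  move=> j [[sj _] [k Jk]]; exists (rcons j k) => //.
  by rewrite -cats1 -sj take_size_cat.
exact: finite_image.
Qed.

(* Main.v *)
(* For j in J^*, the coefficient of z_j in the partial derivative d_k P is an
   integer multiple of c_(j,k).  Cauchy's inequality in t for
   P(z + t w), with |t| = 1/m, gives |sum_k w_k d_k P(z)| <= m (1 + 1/m)^m |P|.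

   For r <= 2, the coefficient of z_j in sum_k w_k d_k P, estimated on the torus
   with radii (e_i / (m-1))^(1/r), e being the exponent of z_j, bounds
   sum_k |c_(j,k)| |u_k|; Hoelder's inequality over J^* and
   sum_e prod_i (m-1)^(e_i) |u_i|^(r e_i) / e_i! <= exp(m-1) conclude.

   For r >= 2, replacing z by u z reduces to the polydisc, where
   sum_k |d_k P|_2 <= 2^((m-1)/2) sum_k |d_k P|_1 <= 2^((m-1)/2) e m |P|
   and the Cauchy-Schwarz inequality over J^* conclude.  The comparison of the
   L^2 and L^1 norms follows, one variable at a time by Minkowski's inequality,
   from sum_k 2^(-k) |a_k|^2 <= |f|_1^2 for f = sum_k a_k z^k.  To prove the
   latter, write f = g h with |g|^2 = |h|^2 = |f| on the circle, so that
   |a_k|^2 <= (k+1) sum_i |g_i|^2 |h_(k-i)|^2.  Integrals over the torus are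
   replaced by averages over roots of unity, and g and h by polynomials, at the
   cost of an arbitrarily small error. *)

Require Import Defs.
From mathcomp Require Import all_boot all_order all_algebra all_solvable all_field finmap.
From mathcomp Require Import complex.
From mathcomp Require Import all_classical all_reals all_analysis ess_sup_inf.
From mathcomp Require Import ring lra.
Import Order.TTheory GRing.Theory Num.Theory ComplexField.Normc.

Set Implicit Arguments.
Unset Strict Implicit.
Unset Printing Implicit Defensive.

Local Open Scope classical_set_scope.
Local Open Scope ring_scope.

(** * Roots of unity *)

Section Modulus.
Local Open Scope complex_scope.
Variable R : realType.
Implicit Types (x y z : R[i]).

Lemma normr_normc z : `|z| = (normc z)%:C.
Proof. by case: z. Qed.

Lemma normc_ge0 z : 0 <= normc z.
Proof. by case: z => a b; exact: sqrtr_ge0. Qed.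

Lemma ler_normcD x y : normc (x + y) <= normc x + normc y.
Proof. by rewrite -lecR rmorphD /= -!normr_normc ler_normD. Qed.

Lemma normc_opp z : normc (- z) = normc z.
Proof. by case: z => a b /=; rewrite !sqrrN. Qed.

Lemma ler_normcB x y : normc (x - y) <= normc x + normc y.
Proof. by rewrite -(normc_opp y) ler_normcD. Qed.

Lemma normcX z k : normc (z ^+ k) = normc z ^+ k.
Proof.
by elim: k => [|k IH]; rewrite ?expr0 ?(normc1 R)// !exprS normcM IH.
Qed.

Lemma normc_sum I (s : seq I) (Q : pred I) (F : I -> R[i]) :
  normc (\sum_(i <- s | Q i) F i) <= \sum_(i <- s | Q i) normc (F i).
Proof.
elim/big_ind2: _ => [|a b c d h1 h2|//]; first by rewrite (normc0 R).
by rewrite (le_trans (ler_normcD _ _))// lerD.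
Qed.

Lemma normc_real (a : R) : 0 <= a -> normc a%:C = a.
Proof. by move=> a0; rewrite /= expr0n /= addr0 sqrtr_sqr ger0_norm. Qed.

Lemma normc_nat (n : nat) : normc (n%:R : R[i]) = n%:R.
Proof. by rewrite -(rmorph_nat (real_complex R)) [LHS]normc_real. Qed.

Lemma normc_conj z : normc z^* = normc z.
Proof. by case: z => a b /=; rewrite sqrrN. Qed.

Lemma sqr_normc_conj z : ((normc z) ^+ 2)%:C = z * z^*.
Proof. by rewrite rmorphXn /= -normr_normc sqr_normc. Qed.

Lemma normc_eq0 z : (normc z == 0) = (z == 0).
Proof. by apply/eqP/eqP => [/eq0_normc//|->]; rewrite (normc0 R). Qed.

Lemma lerB_normc x y : normc x - normc y <= normc (x - y).
Proof. by rewrite lerBlDr -{1}(subrK y x) ler_normcD. Qed.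

Lemma ler_dist_normc x y : `|normc x - normc y| <= normc (x - y).
Proof.
by rewrite ler_norml lerB_normc lerNl opprB -(normc_opp (x - y)) opprB lerB_normc.
Qed.

Lemma exists_phase z : exists2 t, normc t = 1 & t * z = (normc z)%:C.
Proof.
have [->|z0] := eqVneq z 0.
  by exists 1; rewrite ?(normc1 R)// mulr0 (normc0 R).
have nz0 : normc z != 0 by rewrite normc_eq0.
exists (z^* / (normc z)%:C).
  rewrite normcM normcV normc_conj normc_real ?normc_ge0//.
  by rewrite divff.
rewrite mulrAC (mulrC _ z) -sqr_normc_conj rmorphXn /= expr2 mulfK//.
by rewrite (inj_eq (@complexI R) _ 0).
Qed.

End Modulus.

Section RootsOfUnity.
Local Open Scope complex_scope.
Variable R : realType.
Implicit Types (w : R[i]) (p q : {poly R[i]}).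

(** [X^n - 1] splits over the algebraically closed field and is separable in characteristic 0, so it
    has n distinct roots; n distinct n-th roots of unity include a primitive one. *)
Lemma prim_root_complex_exists n : (0 < n)%N ->
  exists w : R[i], n.-primitive_root w.
Proof.
move=> n0; pose p : {poly R[i]} := 'X^n - 1.
have [r Dp] := closed_field_poly_normal p.
have mp : p \is monic by rewrite /p -polyC1 monicXnsubC.
move: Dp; rewrite (monicP mp) scale1r => Dp.
have nz : n%:R != 0 :> R[i] by rewrite pnatr_eq0 -lt0n.
have szr : size r = n.
  by apply: succn_inj; rewrite -(size_prod_XsubC r id) -Dp /p -polyC1 size_XnsubC.
have ur : uniq r.
  rewrite -separable_prod_XsubC -Dp /p.
  by rewrite -polyC1; apply: separable_Xn_sub_1.
have /has_prim_root : all n.-unity_root r.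
  apply/allP => z zr; rewrite /root_of_unity -/p Dp.
  by rewrite root_prod_XsubC.
move=> /(_ n0 ur); rewrite szr leqnn => /(_ isT) /hasP [w _ hw].
by exists w.
Qed.

Lemma normc_prim_root n w : n.-primitive_root w -> normc w = 1.
Proof.
move=> hw; have n0 := prim_order_gt0 hw.
have /eqP : normc w ^+ n = 1 by rewrite -normcX (prim_expr_order hw) (normc1 R).
by rewrite pexpr_eq1 ?normc_ge0// => /eqP.
Qed.

(** With x = w^a conj(w)^b the sum is geometric; x^n = 1, and x = 1 only when a = b because a, b <
    n. *)
Lemma sum_prim_root n w (a b : nat) : n.-primitive_root w ->
  (a < n)%N -> (b < n)%N ->
  \sum_(s < n) (w ^+ s) ^+ a * ((w ^+ s) ^+ b)^* = if a == b then n%:R else 0.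
Proof.
move=> hw an bn; have n0 := prim_order_gt0 hw.
have nw : w * w^* = 1 by rewrite -sqr_normc_conj (normc_prim_root hw) expr1n.
pose x := w ^+ a * (w^*) ^+ b.
have E (s : 'I_n) : (w ^+ s) ^+ a * ((w ^+ s) ^+ b)^* = x ^+ s.
  by rewrite /x !rmorphXn /= exprMn -!exprM mulnC (mulnC b).
rewrite (eq_bigr _ (fun s _ => E s)).
have xn : x ^+ n = 1.
  rewrite /x exprMn -!exprM mulnC (mulnC b) !exprM (prim_expr_order hw).
  rewrite expr1n mul1r -(rmorphXn (@conjc R : {rmorphism _ -> _})) /=.
  by rewrite (prim_expr_order hw) conjc1 expr1n.
have [ab|ab] := eqVneq a b.
  rewrite /x ab -exprMn nw expr1n.
  under eq_bigr do rewrite expr1n.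
  by rewrite sumr_const card_ord.
have x1 : x != 1.
  apply: contra ab => /eqP /(congr1 ( *%R ^~ (w ^+ b))).
  rewrite /x mul1r -mulrA (mulrC (_ ^+ b)) -exprMn nw expr1n mulr1 => /eqP.
  by rewrite (eq_prim_root_expr hw) !modn_small.
apply: (mulfI (_ : x - 1 != 0)); first by rewrite subr_eq0.
by rewrite mulr0 -subrX1 xn subrr.
Qed.

Lemma coef_sum_prim_root n w p (k : nat) : n.-primitive_root w ->
  (size p <= n)%N -> (k < n)%N ->
  \sum_(s < n) p.[w ^+ s] * ((w ^+ s) ^+ k)^* = n%:R * p`_k.
Proof.
move=> hw pn kn.
under eq_bigr do rewrite (horner_coef_wide _ pn) mulr_suml.
rewrite exchange_big /= (bigD1 (Ordinal kn)) //= [X in _ + X]big1 ?addr0.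
  under eq_bigr do rewrite -mulrA.
  by rewrite -mulr_sumr sum_prim_root// eqxx mulrC.
move=> i ik; under eq_bigr do rewrite -mulrA.
rewrite -mulr_sumr sum_prim_root// ifF ?mulr0//.
by apply/negbTE; apply: contra ik => /eqP E; apply/eqP/val_inj.
Qed.

(** The degree of p is below n, so no two of its exponents are congruent modulo n and sampling at
    the n-th roots of unity is exact. *)
Lemma parseval n w p : n.-primitive_root w -> (size p <= n)%N ->
  \sum_(s < n) normc p.[w ^+ s] ^+ 2 = n%:R * \sum_(i < n) normc p`_i ^+ 2.
Proof.
move=> hw pn; apply: (@complexI R); rewrite rmorphM !rmorph_sum /= rmorph_nat.
under eq_bigr do rewrite sqr_normc_conj.
under [in RHS]eq_bigr do rewrite sqr_normc_conj.
rewrite mulr_sumr.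
transitivity (\sum_(s < n) \sum_(i < n)
    (p`_i)^* * (p.[w ^+ s] * ((w ^+ s) ^+ i)^*)).
  apply: eq_bigr => s _; rewrite [in X in _ * X](horner_coef_wide _ pn).
  rewrite rmorph_sum /= mulr_sumr; apply: eq_bigr => i _.
  by rewrite rmorphM /= mulrCA.
rewrite exchange_big /=; apply: eq_bigr => i _.
by rewrite -mulr_sumr coef_sum_prim_root// mulrCA (mulrC _^*).
Qed.

Lemma normc_coef_le_avg n w p (k : nat) : n.-primitive_root w ->
  (size p <= n)%N -> (k < n)%N ->
  normc p`_k <= n%:R^-1 * \sum_(s < n) normc p.[w ^+ s].
Proof.
move=> hw pn kn; have n0 := prim_order_gt0 hw.
rewrite ler_pdivlMl ?ltr0n// -normc_nat -normcM -(coef_sum_prim_root hw)//.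
rewrite (le_trans (normc_sum _ _ _))//; apply: ler_sum => s _.
by rewrite normcM normc_conj !normcX (normc_prim_root hw) !expr1n mulr1.
Qed.

Lemma normc_coef_le p (k : nat) (M : R) : 0 <= M ->
  (forall z, normc z = 1 -> normc p.[z] <= M) -> normc p`_k <= M.
Proof.
(* The order exceeds both the degree of p and k, so that averaging over the roots of unity extracts
   the k-th coefficient. *)
move=> M0 pM; have [w hw] := @prim_root_complex_exists (maxn (size p) k.+1)
  (leq_ltn_trans (leq0n k) (leq_maxr _ _)).
have n0 := prim_order_gt0 hw.
rewrite (le_trans (normc_coef_le_avg hw (leq_maxl _ _) (leq_maxr _ _)))//.
rewrite ler_pdivrMl ?ltr0n// mulr_natl -[X in _ *+ X]card_ord -sumr_const.
by apply: ler_sum => s _; apply: pM; rewrite normcX (normc_prim_root hw) expr1n.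
Qed.

End RootsOfUnity.

(** * Weighted square norms and factorization on the circle *)

Section WeightedL2.
Variables (R : realType) (I : Type) (s : seq I) (w : I -> R).
Hypothesis w0 : forall i, 0 <= w i.
Implicit Types (x y : I -> R).

Definition l2norm x : R := Num.sqrt (\sum_(i <- s) w i * x i ^+ 2).

Lemma l2norm_ge0 x : 0 <= l2norm x.
Proof. exact: sqrtr_ge0. Qed.

Let sum_ge0 x : 0 <= \sum_(i <- s) w i * x i ^+ 2.
Proof. by apply: sumr_ge0 => i _; rewrite mulr_ge0 ?sqr_ge0. Qed.

Lemma sqr_l2norm x : l2norm x ^+ 2 = \sum_(i <- s) w i * x i ^+ 2.
Proof. by rewrite sqr_sqrtr. Qed.

Lemma eq_l2norm x y : x =1 y -> l2norm x = l2norm y.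
Proof. by move=> xy; congr Num.sqrt; apply: eq_bigr => i _; rewrite xy. Qed.

Lemma ler_l2norm x y : (forall i, 0 <= x i <= y i) -> l2norm x <= l2norm y.
Proof.
move=> xy; rewrite ler_wsqrtr//; apply: ler_sum => i _; rewrite ler_wpM2l//.
by have /andP[x0 xyi] := xy i; rewrite lerXn2r ?nnegrE// (le_trans x0).
Qed.

(** Lagrange's identity: 2 (A C - B^2) is the double sum of w_i w_j (x_i y_j - x_j y_i)^2. *)
Lemma l2norm_CS x y : \sum_(i <- s) w i * (x i * y i) <= l2norm x * l2norm y.
Proof.
rewrite (le_trans (ler_norm _))// -sqrtr_sqr -sqrtrM// ler_wsqrtr//.
set A := (X in _ <= X * _); set C := (X in _ <= _ * X); set B := (X in X ^+ 2 <= _).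
rewrite -subr_ge0 -(pmulr_rge0 _ (ltr0n R 2)).
have -> : 2 * (A * C - B ^+ 2) = A * C + C * A + (-2) * (B * B) by ring.
rewrite /A /B /C !big_distrlr mulr_sumr -!big_split /=.
apply: sumr_ge0 => i _; rewrite mulr_sumr -!big_split /=.
apply: sumr_ge0 => j _.
have := mulr_ge0 (mulr_ge0 (w0 i) (w0 j)) (sqr_ge0 (x i * y j - x j * y i)).
by congr (0 <= _); ring.
Qed.

Lemma l2normD x y : l2norm (fun i => x i + y i) <= l2norm x + l2norm y.
Proof.
rewrite -(ler_pXn2r (ltn0Sn 1)) ?nnegrE ?addr_ge0 ?l2norm_ge0//.
rewrite sqrrD !sqr_l2norm.
have -> : \sum_(i <- s) w i * (x i + y i) ^+ 2 = \sum_(i <- s) w i * x i ^+ 2 +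
   (\sum_(i <- s) w i * (x i * y i)) *+ 2 + \sum_(i <- s) w i * y i ^+ 2.
  by rewrite -mulr_natl mulr_sumr -!big_split /=; apply: eq_bigr => i _; ring.
by rewrite lerD2r lerD2l lerMn2r l2norm_CS orbT.
Qed.

Lemma l2norm_sum (T : Type) (S : seq T) (F : T -> I -> R) :
  l2norm (fun i => \sum_(t <- S) F t i) <= \sum_(t <- S) l2norm (F t).
Proof.
elim: S => [|t S IH].
  rewrite big_nil; under [X in X <= _]eq_l2norm do rewrite big_nil.
  rewrite /l2norm big1 ?sqrtr0// => i _; by rewrite expr0n mulr0.
under eq_l2norm do rewrite big_cons.
by rewrite big_cons (le_trans (l2normD _ _))// lerD2l.
Qed.

Lemma l2normZ (c : R) x : 0 <= c -> l2norm (fun i => c * x i) = c * l2norm x.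
Proof.
move=> c0; rewrite /l2norm -{2}(ger0_norm c0) -sqrtr_sqr -sqrtrM ?sqr_ge0//.
by congr Num.sqrt; rewrite mulr_sumr; apply: eq_bigr => i _; ring.
Qed.

End WeightedL2.

(** * Approximate factorization on the circle into two factors of equal modulus *)

Section ApproximateSquares.
Local Open Scope complex_scope.
Variable R : realType.
Implicit Types (f g h p q : {poly R[i]}) (z a : R[i]) (e : R).

(** On the unit circle, f = g h with |g|^2 = |h|^2 = |f|, up to e. The exact factors involve square
    roots, which are in general not polynomials; polynomial factors make Parseval at roots of unity
    available. *)
Definition splits_evenly f := forall e, 0 < e -> exists g h, forall z,
  normc z = 1 ->
  [/\ normc (g.[z] * h.[z] - f.[z]) <= e,
      `|normc g.[z] ^+ 2 - normc f.[z]| <= e &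
      `|normc h.[z] ^+ 2 - normc f.[z]| <= e].

Lemma dist_sqr_normc_le (x y : R[i]) e :
  normc (x ^+ 2 - y) <= e -> `|normc x ^+ 2 - normc y| <= e.
Proof. by move=> h; rewrite -normcX (le_trans (ler_dist_normc _ _)). Qed.

Lemma splits_evenly_square f :
  (forall e, 0 < e -> exists g, forall z, normc z = 1 ->
     normc (g.[z] ^+ 2 - f.[z]) <= e) -> splits_evenly f.
Proof.
move=> H e e0; have [g hg] := H _ e0; exists g, g => z z1.
by have h := hg z z1; split; rewrite ?dist_sqr_normc_le.
Qed.

Lemma splits_evenlyC (c : R[i]) : splits_evenly c%:P.
Proof.
apply: splits_evenly_square => e e0; exists (sqrtc c)%:P => z _.
by rewrite !hornerC sqr_sqrtc subrr (normc0 R) ltW.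
Qed.

Lemma normc_horner_le f : exists2 M : R, 0 <= M &
  forall z, normc z = 1 -> normc f.[z] <= M.
Proof.
exists (\sum_(i < size f) normc f`_i); first by apply: sumr_ge0 => i _; apply: normc_ge0.
move=> z z1; rewrite horner_coef (le_trans (normc_sum _ _ _))//.
by apply: ler_sum => i _; rewrite normcM normcX z1 expr1n mulr1.
Qed.

Lemma splits_evenlyM f1 f2 :
  splits_evenly f1 -> splits_evenly f2 -> splits_evenly (f1 * f2).
Proof.
move=> H1 H2 e e0.
have [M1 M10 hM1] := normc_horner_le f1.
have [M2 M20 hM2] := normc_horner_le f2.
(* An error d in each factor changes a product by at most d^2 + (M1 + M2) d, which is at most d (M1
   + M2 + 1) as d <= 1. *)
pose d := Num.min 1 (e / (M1 + M2 + 1)).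
have MM : 0 < M1 + M2 + 1 by lra.
have d0 : 0 < d by rewrite lt_min ltr01 divr_gt0.
have d1 : d <= 1 by rewrite ge_min lexx.
have de : d * (M1 + M2 + 1) <= e.
  by rewrite -ler_pdivlMr// ge_min lexx orbT.
have [g1 [h1 A1]] := H1 _ d0; have [g2 [h2 A2]] := H2 _ d0.
have real_prod (x y x' y' : R) : 0 <= x' <= M1 -> 0 <= y' <= M2 ->
    `|x - x'| <= d -> `|y - y'| <= d -> `|x * y - x' * y'| <= e.
  move=> /andP[x0 xM] /andP[y0 yM] dx dy.
  have -> : x * y - x' * y' = (x - x') * (y - y') + x' * (y - y') + y' * (x - x').
    by ring.
  have a1 : `|(x - x') * (y - y')| <= d * 1.
    by rewrite normrM ler_pM// (le_trans dy).
  have a2 : `|x' * (y - y')| <= M1 * d by rewrite normrM ler_pM// ger0_norm.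
  have a3 : `|y' * (x - x')| <= M2 * d by rewrite normrM ler_pM// ger0_norm.
  have := ler_normD ((x - x') * (y - y') + x' * (y - y')) (y' * (x - x')).
  have := ler_normD ((x - x') * (y - y')) (x' * (y - y')).
  by lra.
exists (g1 * g2), (h1 * h2) => z z1.
have [a b c] := A1 z z1; have [a' b' c'] := A2 z z1.
rewrite !hornerM !normcM !exprMn.
split; [|by apply: real_prod; rewrite ?normc_ge0 ?hM1 ?hM2..].
set x := g1.[z] * h1.[z] in a; set y := g2.[z] * h2.[z] in a'.
have -> : g1.[z] * g2.[z] * (h1.[z] * h2.[z]) - f1.[z] * f2.[z] =
  (x - f1.[z]) * (y - f2.[z]) + f1.[z] * (y - f2.[z]) + f2.[z] * (x - f1.[z]).
  by rewrite /x /y; ring.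
have a1 : normc ((x - f1.[z]) * (y - f2.[z])) <= d * 1.
  by rewrite normcM ler_pM ?normc_ge0// (le_trans a').
have a2 : normc (f1.[z] * (y - f2.[z])) <= M1 * d.
  by rewrite normcM ler_pM ?normc_ge0// hM1.
have a3 : normc (f2.[z] * (x - f1.[z])) <= M2 * d.
  by rewrite normcM ler_pM ?normc_ge0// hM2.
have := ler_normcD ((x - f1.[z]) * (y - f2.[z]) + f1.[z] * (y - f2.[z]))
  (f2.[z] * (x - f1.[z])).
have := ler_normcD ((x - f1.[z]) * (y - f2.[z])) (f1.[z] * (y - f2.[z])).
by lra.
Qed.

(** Half of e is spent on replacing f by f', half on splitting f'. This handles roots on the circle,
    as limits of roots outside it. *)
Lemma splits_evenly_closed f :
  (forall d, 0 < d -> exists2 f', splits_evenly f' &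
     forall z, normc z = 1 -> normc (f'.[z] - f.[z]) <= d) -> splits_evenly f.
Proof.
move=> H e e0; have e20 : 0 < e / 2 by lra.
have [f' Hf' ff'] := H _ e20; have [g [h gh]] := Hf' _ e20.
exists g, h => z z1; have [a b c] := gh z z1; have d := ff' z z1.
have d' := le_trans (ler_dist_normc _ _) d.
split.
- have -> : g.[z] * h.[z] - f.[z] = (g.[z] * h.[z] - f'.[z]) + (f'.[z] - f.[z]).
    by ring.
  by rewrite (le_trans (ler_normcD _ _))//; lra.
- have := ler_normD (normc g.[z] ^+ 2 - normc f'.[z]) (normc f'.[z] - normc f.[z]).
  by rewrite addrA subrK; lra.
- have := ler_normD (normc h.[z] ^+ 2 - normc f'.[z]) (normc f'.[z] - normc f.[z]).
  by rewrite addrA subrK; lra.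
Qed.

(** Bernoulli's inequality for the powers of 1/x = 1 + d. *)
Lemma geometric_small (x e : R) : 0 <= x < 1 -> 0 < e -> exists n, x ^+ n <= e.
Proof.
move=> /andP[]; rewrite le_eqVlt => /predU1P[<-|x0] x1 e0.
  by exists 1; rewrite expr1 ltW.
pose d := x^-1 - 1; have d0 : 0 < d by rewrite subr_gt0 invf_gt1.
have bern k : 1 + d *+ k <= x^-1 ^+ k.
  elim: k => [|k IH]; first by rewrite mulr0n addr0 expr0.
  rewrite exprS -{1}(subrK 1 x^-1) -/d mulrDl mul1r mulrS.
  have : d * 1 <= d * x^-1 ^+ k.
    by rewrite ler_pM2l// exprn_ege1// ltW// invf_gt1.
  by lra.
exists (Num.bound (e^-1 / d)).
set k := Num.bound _.
have kb : e^-1 <= d *+ k.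
  have ed : 0 <= e^-1 / d by rewrite ltW// divr_gt0 ?invr_gt0.
  have := archi_boundP ed; rewrite -/k.
  by rewrite ltr_pdivrMr// mulr_natl; exact: ltW.
have := bern k; rewrite exprVn => bk.
by rewrite -[x ^+ k]invrK -[e]invrK lef_pV2 ?posrE ?invr_gt0 ?exprn_gt0//; lra.
Qed.

(* The iterates of [y := (a X + y^2) / 2] converge to [1 - sqrt (1 - a X)]. *)
Fixpoint sqrt_iter a n : {poly R[i]} :=
  if n is n'.+1 then 2^-1 *: (a *: 'X + sqrt_iter a n' ^+ 2) else 0.

Let normc_half : normc (2^-1 : R[i]) = 2^-1.
Proof. by rewrite normcV normc_nat. Qed.

Lemma sqrt_iterS a n z :
  (sqrt_iter a n.+1).[z] = 2^-1 * (a * z + (sqrt_iter a n).[z] ^+ 2).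
Proof. by rewrite /= !hornerE. Qed.

(** The disc of radius |a| is stable under the iteration, since (|a| + |a|^2) / 2 <= |a|. *)
Lemma normc_sqrt_iter a n z : normc a < 1 -> normc z = 1 ->
  normc (sqrt_iter a n).[z] <= normc a.
Proof.
move=> a1 z1; have a0 := normc_ge0 a.
elim: n => [|n IH]; first by rewrite /= horner0 (normc0 R).
rewrite sqrt_iterS normcM normc_half.
have := ler_normcD (a * z) ((sqrt_iter a n).[z] ^+ 2).
rewrite normcM z1 mulr1 normcX.
have : normc (sqrt_iter a n).[z] ^+ 2 <= normc a ^+ 2.
  by rewrite lerXn2r ?nnegrE ?normc_ge0.
have : normc a ^+ 2 <= normc a by rewrite expr2 ler_piMl ?(ltW a1).
by lra.
Qed.

(** Consecutive differences contract by the factor |a|: u^2 - v^2 = (u + v)(u - v), and |u + v| <= 2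
    |a| on the stable disc. *)
Lemma sqrt_iter_step a n z : normc a < 1 -> normc z = 1 ->
  normc ((sqrt_iter a n.+1).[z] - (sqrt_iter a n).[z]) <= normc a ^+ n.
Proof.
move=> a1 z1; elim: n => [|n IH].
  rewrite /= [X in _ - X]horner0 subr0 expr0 (le_trans _ (ltW a1))//.
  exact: (normc_sqrt_iter 1).
rewrite (sqrt_iterS a n.+1) [X in _ - X](sqrt_iterS a n).
set u := (sqrt_iter a n.+1).[z] in IH *; set v := (sqrt_iter a n).[z] in IH *.
have -> : 2^-1 * (a * z + u ^+ 2) - 2^-1 * (a * z + v ^+ 2) =
  2^-1 * ((u + v) * (u - v)) by ring.
rewrite !normcM normc_half.
have uv : normc (u + v) <= 2 * normc a.
  rewrite (le_trans (ler_normcD _ _))//.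
  have := normc_sqrt_iter n.+1 a1 z1; have := normc_sqrt_iter n a1 z1.
  by rewrite -/u -/v; lra.
have : normc (u + v) * normc (u - v) <= 2 * normc a * normc a ^+ n.
  by rewrite ler_pM ?normc_ge0.
by rewrite exprS; lra.
Qed.

(** If y' is the iterate after y, then (1 - y)^2 - (1 - a z) = 2 (y' - y), so a small step of the
    iteration is a small residual. *)
Lemma sqrt_approx a e : normc a < 1 -> 0 < e -> exists p, forall z,
  normc z = 1 -> normc (p.[z] ^+ 2 - (1 - a * z)) <= e.
Proof.
move=> a1 e0; have e20 : 0 < e / 2 by lra.
have [n hn] := @geometric_small (normc a) _ (introT andP (conj (normc_ge0 a) a1)) e20.
exists (1 - sqrt_iter a n) => z z1.
have := sqrt_iter_step n a1 z1; rewrite sqrt_iterS !hornerE.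
set y := (sqrt_iter a n).[z].
have -> : (1 - y) ^+ 2 - (1 - a * z) = 2 * (2^-1 * (a * z + y ^+ 2) - y) by field.
by rewrite normcM normc_nat; lra.
Qed.

Lemma splits_evenly_outer a : normc a < 1 -> splits_evenly (1 - a *: 'X).
Proof.
move=> a1; apply: splits_evenly_square => e e0.
have [p hp] := sqrt_approx a1 e0; exists p => z z1.
by rewrite !hornerE; exact: hp.
Qed.

Lemma splits_evenly_XsubC_out a : 1 < normc a -> splits_evenly ('X - a%:P).
Proof.
move=> a1.
have a0 : a != 0 by rewrite -normc_eq0; apply: contraTneq a1 => ->; rewrite -leNgt.
have -> : 'X - a%:P = (- a)%:P * (1 - a^-1 *: 'X).
  rewrite mulrBr mulr1 -mul_polyC mulrA -polyCM mulNr mulfV//.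
  by rewrite !polyCN mulN1r opprK addrC.
apply: splits_evenlyM; first exact: splits_evenlyC.
by apply: splits_evenly_outer; rewrite normcV invf_lt1// (lt_trans ltr01).
Qed.

(* With [b = conj a], on the circle [|z - a| = |1 - b z|], and [geo] below
   approximates [1 / (1 - b z)], so that [(z - a) / sqrt (1 - b z)] and
   [sqrt (1 - b z)] have the same modulus and product [z - a]. *)
Lemma splits_evenly_XsubC_in a : normc a < 1 -> splits_evenly ('X - a%:P).
Proof.
move=> a1 e e0; set b := a^*.
have nb : normc b = normc a by rewrite normc_conj.
have b1 : normc b < 1 by rewrite nb.
have a0 := normc_ge0 a.
(* The three errors below are at most 4 d, 10 d and d, all within e because 16 d <= e. *)
pose d := Num.min 1 (e * (1 - normc a) / 16).
have sa : 0 < 1 - normc a by lra.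
have d0 : 0 < d by rewrite lt_min ltr01 divr_gt0// mulr_gt0.
have d1 : d <= 1 by rewrite ge_min lexx.
have de : 16 * d <= e * (1 - normc a).
  have : d <= e * (1 - normc a) / 16 by rewrite ge_min lexx orbT.
  by lra.
have de1 : 16 * d <= e by nra.
have [p hp] := sqrt_approx b1 d0.
have [n hn] := @geometric_small (normc b) _ (introT andP (conj (normc_ge0 b) b1)) d0.
pose geo := \sum_(i < n) (b *: 'X) ^+ i.
have geoE z : (1 - b * z) * geo.[z] = 1 - (b * z) ^+ n.
  rewrite -opprB -[1 - _ in RHS]opprB (subrX1 (b * z)) mulNr; congr (- (_ * _)).
  by rewrite /geo horner_sum; apply: eq_bigr => i _; rewrite !hornerE.
exists (('X - a%:P) * p * geo), p => z z1.
have zz : z * z^* = 1 by rewrite -sqr_normc_conj z1 expr1n.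
rewrite !hornerE /=.
have nE : normc (z - a) = normc (1 - b * z).
  rewrite -[RHS]normc_conj rmorphB rmorph1 rmorphM /= /b conjcK.
  have -> : z - a = z * (1 - a * z^*) by rewrite mulrBr mulr1 mulrCA zz mulr1.
  by rewrite normcM z1 mul1r.
have hT := hp z z1; have hG := geoE z.
have bn : normc ((b * z) ^+ n) <= d by rewrite normcX normcM z1 mulr1.
set B := normc (z - a) in nE *.
have B2 : B <= 2 by rewrite (le_trans (ler_normcB _ _))// z1; lra.
have Bl : 1 - normc a <= B by rewrite -z1; exact: lerB_normc.
have B0 : 0 <= B := normc_ge0 _.
set G := normc geo.[z].
have G0 : 0 <= G := normc_ge0 _.
have nBG : normc ((1 - b * z) * geo.[z]) = B * G by rewrite normcM -nE.
have BG : `|B * G - 1| <= d.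
  rewrite -nBG hG -(normc1 R) (le_trans (ler_dist_normc _ _))//.
  by rewrite (_ : 1 - _ - 1 = - (b * z) ^+ n) ?normc_opp//; ring.
have hT' : `|normc p.[z] ^+ 2 - B| <= d.
  by rewrite nE; apply: dist_sqr_normc_le.
split; last by rewrite (le_trans hT'); lra.
- set t := p.[z] in hT *; set c := geo.[z] in hG nBG BG *.
  have -> : (z - a) * t * c * t - (z - a) =
    (z - a) * c * (t ^+ 2 - (1 - b * z)) + (z - a) * ((1 - b * z) * c - 1) by ring.
  rewrite (le_trans (ler_normcD _ _))// !normcM -/B -/G hG.
  rewrite (_ : 1 - _ - 1 = - (b * z) ^+ n); last by ring.
  rewrite normc_opp.
  have h1 : B * G <= 2 by move: BG; rewrite ler_norml; lra.
  have : B * G * normc (t ^+ 2 - (1 - b * z)) <= 2 * d.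
    by rewrite ler_pM// ?normc_ge0// mulr_ge0.
  have : B * normc ((b * z) ^+ n) <= 2 * d by rewrite ler_pM// normc_ge0.
  by lra.
- rewrite !normcM !exprMn -/B -/G; set T := normc _ ^+ 2 in hT' *.
  have -> : B ^+ 2 * T * G ^+ 2 - B =
     (B * G) ^+ 2 * (T - B) + B * (B * G + 1) * (B * G - 1) by ring.
  have h1 : 0 <= B * G <= 2 by move: BG; rewrite ler_norml mulr_ge0//; lra.
  rewrite (le_trans (ler_normD _ _))//.
  rewrite [ `|_ ^+ 2 * _|]normrM (ger0_norm (sqr_ge0 _)).
  rewrite [ `|_ * (B * G - 1)|]normrM (@ger0_norm _ (B * (B * G + 1))); last first.
    by rewrite mulr_ge0//; lra.
  have /andP[h10 h12] := h1.
  have : (B * G) ^+ 2 * `|T - B| <= 4 * d.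
    rewrite ler_pM ?sqr_ge0//; nra.
  have : B * (B * G + 1) * `|B * G - 1| <= 6 * d.
    rewrite ler_pM// ?mulr_ge0//; nra.
  by lra.
Qed.

Lemma splits_evenly_XsubC a : splits_evenly ('X - a%:P).
Proof.
have [a1|a1|a1] := ltrgtP (normc a) 1.
- exact: splits_evenly_XsubC_in.
- exact: splits_evenly_XsubC_out.
(* A root on the circle is moved out to radius 1 + d. *)
apply: splits_evenly_closed => d d0; exists ('X - ((1 + d)%:C * a)%:P).
  apply: splits_evenly_XsubC_out.
  by rewrite normcM a1 mulr1 normc_real; lra.
move=> z _; rewrite !hornerE.
have -> : z - (1 + d)%:C * a - (z - a) = - (d%:C * a).
  by rewrite rmorphD rmorph1 /=; ring.
by rewrite normc_opp normcM a1 mulr1 normc_real// ltW.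
Qed.

(** The property is multiplicative, and f is a constant times a product of linear factors. *)
Lemma splits_evenlyP f : splits_evenly f.
Proof.
have [r ->] := closed_field_poly_normal f.
rewrite -mul_polyC; apply: splits_evenlyM; first exact: splits_evenlyC.
elim/big_ind: _ => //; first by rewrite -polyC1; apply: splits_evenlyC.
  exact: splits_evenlyM.
by move=> i _; apply: splits_evenly_XsubC.
Qed.

End ApproximateSquares.

(** * Comparison of the quadratic and the absolute mean *)

Section OneVariable.
Local Open Scope complex_scope.
Variable R : realType.
Implicit Types (f g h p q : {poly R[i]}) (z a : R[i]) (e : R).

Definition half_pow (k : nat) : R := 2^-1 ^+ k.

Lemma half_pow_ge0 k : 0 <= half_pow k.
Proof. by rewrite exprn_ge0// invr_ge0. Qed.

Lemma sqr_sum_le (n : nat) (x : 'I_n -> R) : (forall i, 0 <= x i) ->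
  (\sum_i x i) ^+ 2 <= n%:R * \sum_i x i ^+ 2.
Proof.
move=> x0; have w0 (i : 'I_n) : 0 <= (fun=> 1 : R) i by [].
have := l2norm_CS (index_enum 'I_n) w0 x (fun=> 1).
have -> : \sum_i 1 * (x i * 1) = \sum_i x i.
  by apply: eq_bigr => i _; rewrite mul1r mulr1.
set X := l2norm _ _ _; set Y := l2norm _ _ _ => h.
have -> : n%:R * \sum_i x i ^+ 2 = (X * Y) ^+ 2.
  rewrite exprMn !sqr_l2norm// mulrC; congr (_ * _).
    by apply: eq_bigr => i _; rewrite mul1r.
  by rewrite expr1n mulr1 sumr_const card_ord.
by rewrite lerXn2r ?nnegrE ?mulr_ge0 ?l2norm_ge0// sumr_ge0.
Qed.

Lemma half_pow_succ k : half_pow k * k.+1%:R <= 1.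
Proof.
rewrite /half_pow exprVn mulrC ler_pdivrMr ?exprn_gt0// mul1r -natrX ler_nat.
exact: ltn_expl.
Qed.

(** The k-th coefficient of g h has k + 1 terms, so Cauchy-Schwarz costs a factor k + 1, which the
    weight 2^(-k) absorbs. *)
Lemma carleman D n g h : (size g <= n)%N -> (size h <= n)%N ->
  \sum_(0 <= k < D) half_pow k * normc (g * h)`_k ^+ 2 <=
  (\sum_(i < n) normc g`_i ^+ 2) * (\sum_(i < n) normc h`_i ^+ 2).
Proof.
move=> gn hn.
(* The coefficients of [sq g * sq h] are the convolutions of |g_i|^2 and |h_i|^2, and their total is
   its value at 1, the product of the two square sums. *)
pose sq f : {poly R} := \poly_(i < n) normc f`_i ^+ 2.
have sqE f : (size f <= n)%N -> forall i, (sq f)`_i = normc f`_i ^+ 2.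
  move=> fn i; rewrite coef_poly; case: ltnP => // ni.
  by rewrite nth_default ?(normc0 R) ?expr0n// (leq_trans fn).
have sq1 f : (sq f).[1] = \sum_(i < n) normc f`_i ^+ 2.
  by rewrite horner_poly; apply: eq_bigr => i _; rewrite expr1n mulr1.
have sq0 k : 0 <= (sq g * sq h)`_k.
  rewrite coefM; apply: sumr_ge0 => i _.
  by rewrite !sqE// mulr_ge0 ?sqr_ge0.
rewrite -!sq1 -hornerM (horner_coef_wide _ (leq_maxr D _)).
under [leRHS]eq_bigr do rewrite expr1n mulr1.
rewrite -(big_mkord xpredT (fun i => (sq g * sq h)`_i)).
rewrite [leRHS](big_cat_nat _ (leq_maxl D _))//=.
rewrite ler_wpDr ?sumr_ge0//; apply: ler_sum => k _.
rewrite !coefM.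
have h1 : normc (\sum_(j < k.+1) g`_j * h`_(k - j)) ^+ 2 <=
    (\sum_(j < k.+1) normc (g`_j) * normc h`_(k - j)) ^+ 2.
  rewrite lerXn2r ?nnegrE ?normc_ge0//.
    by apply: sumr_ge0 => j _; rewrite mulr_ge0 ?normc_ge0.
  rewrite (le_trans (normc_sum _ _ _))//.
  by apply: ler_sum => j _; rewrite normcM.
have h2 := le_trans h1 (sqr_sum_le _).
have {}h2 := h2 (fun j => mulr_ge0 (normc_ge0 _) (normc_ge0 _)).
rewrite (le_trans (ler_wpM2l (half_pow_ge0 k) h2))// mulrA.
under [leRHS]eq_bigr do rewrite !sqE// -exprMn.
apply: ler_piMl (half_pow_succ k).
by apply: sumr_ge0 => j _; apply: sqr_ge0.
Qed.

Notation wnorm D := (l2norm (index_iota 0 D) half_pow).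

(** The degrees of the factors g and h depend on e, whence the threshold N. Parseval bounds their
    square sums by the mean of |p| plus d, [carleman] transfers this to g h, and the coefficients of
    p and g h differ by at most d, since the two are uniformly close on the circle. *)
Lemma l2norm_le_avg_eventually D p e : 0 < e -> exists N, forall n w,
  (N <= n)%N -> n.-primitive_root w ->
  wnorm D (fun k => normc p`_k) <=
    n%:R^-1 * \sum_(s < n) normc p.[w ^+ s] + e.
Proof.
(* The error in the mean costs d; an error d in every coefficient costs d K. *)
move=> e0; pose K := wnorm D (fun=> 1); pose d := e / (1 + K).
have K0 : 0 <= K by apply: l2norm_ge0.
have d0 : 0 < d by rewrite divr_gt0//; lra.
have dK : d + d * K = e by rewrite /d; field; lra.
have [g [h gh]] := splits_evenlyP p d0.
exists (maxn (size g) (size h)).+1 => n w nN hw.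
have n0 : 0 < n%:R :> R by rewrite ltr0n (prim_order_gt0 hw).
have w1 (s : 'I_n) : normc (w ^+ s) = 1 by rewrite normcX (normc_prim_root hw) expr1n.
set A := _ * _.
have A0 : 0 <= A.
  by rewrite mulr_ge0 ?invr_ge0 ?ler0n// sumr_ge0// => i _; apply: normc_ge0.
have gn : (size g <= n)%N.
  by rewrite (leq_trans (leq_trans (leq_maxl _ _) (leqnSn _)) nN).
have hn : (size h <= n)%N.
  by rewrite (leq_trans (leq_trans (leq_maxr _ _) (leqnSn _)) nN).
have key f : (size f <= n)%N ->
    (forall s : 'I_n, `|normc f.[w ^+ s] ^+ 2 - normc p.[w ^+ s]| <= d) ->
    \sum_(i < n) normc f`_i ^+ 2 <= A + d.
  move=> fn fp; rewrite -(ler_pM2l n0) -(parseval hw fn) mulrDr mulrA divff ?gt_eqF//.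
  rewrite mul1r mulr_natl -[X in _ *+ X]card_ord -sumr_const -big_split /=.
  by apply: ler_sum => s _; move: (fp s); rewrite ler_norml; lra.
have kg := key g gn (fun s => let: And3 _ H _ := gh _ (w1 s) in H).
have kh := key h hn (fun s => let: And3 _ _ H := gh _ (w1 s) in H).
have q1 : wnorm D (fun k => normc (g * h)`_k) <= A + d.
  rewrite -[leRHS]ger0_norm; last by lra.
  rewrite -sqrtr_sqr ler_wsqrtr// (le_trans (carleman _ gn hn))// expr2.
  by rewrite ler_pM// sumr_ge0// => i _; apply: sqr_ge0.
have pq k : normc p`_k <= normc (g * h)`_k + d * 1.
  rewrite mulr1 -{1}(subrK ((g * h)`_k) p`_k) addrC (le_trans (ler_normcD _ _))//.
  rewrite lerD2l -coefB; apply: normc_coef_le; first exact: ltW.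
  move=> z z1; rewrite hornerD hornerN -normc_opp opprB hornerM.
  by have [] := gh z z1.
apply: le_trans (_ : wnorm D (fun k => normc (g * h)`_k + d * 1) <= _).
  by apply: ler_l2norm => [|k]; rewrite ?normc_ge0 ?pq//; exact: half_pow_ge0.
rewrite (le_trans (l2normD _ _ _ _))//; first exact: half_pow_ge0.
by rewrite l2normZ ?(ltW d0)// -/K; lra.
Qed.

(** One order n must serve a whole finite family in the induction on the number of variables. *)
Lemma l2norm_le_avg_family (T : finType) D (p : T -> {poly R[i]}) e : 0 < e ->
  exists n w, n.-primitive_root w /\ forall t,
  wnorm D (fun k => normc (p t)`_k) <=
    n%:R^-1 * \sum_(s < n) normc (p t).[w ^+ s] + e.
Proof.
move=> e0.
have [N hN] := fin_all_exists (fun t => @l2norm_le_avg_eventually D (p t) e e0).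
have [w hw] := @prim_root_complex_exists R (\max_t N t).+1 (ltn0Sn _).
exists (\max_t N t).+1, w; split=> // t; apply: hN => //.
by rewrite ltnW// ltnS leq_bigmax.
Qed.

End OneVariable.

(** * Polynomials in several variables, indexed by exponent tuples *)

Section MultivariatePolynomials.
Variable K : comNzRingType.
Implicit Types (z : seq K) (a : seq nat -> K) (e : seq nat) (D n : nat).

Fixpoint expo D n : seq (seq nat) :=
  if n is n'.+1 then [seq k :: e | k <- index_iota 0 D, e <- expo D n'] else [:: [::]].

Lemma mem_expo D n e :
  (e \in expo D n) = (size e == n) && all (fun k => (k < D)%N) e.
Proof.
elim: n e => [|n IH] e /=; first by rewrite inE; case: e.
apply/allpairsP/idP => [[[k e'] /= [kD]]|].
  rewrite IH => /andP[/eqP <- h] ->; rewrite /= eqxx.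
  by move: kD; rewrite mem_index_iota /= => ->.
case: e => // k e /andP[sz /andP[kD h]]; exists (k, e).
by rewrite /= mem_index_iota kD IH -eqSS sz.
Qed.

Lemma uniq_expo D n : uniq (expo D n).
Proof.
elim: n => [//|n IH] /=; apply: allpairs_uniq; rewrite ?iota_uniq//.
by move=> [k e] [k' e'] _ _ /= [-> ->].
Qed.

Definition mon e z : K := \prod_(p <- zip e z) p.2 ^+ p.1.

Lemma mon_cons k e x z : mon (k :: e) (x :: z) = x ^+ k * mon e z.
Proof. by rewrite /mon /= big_cons. Qed.

Definition mpol D n a z : K := \sum_(e <- expo D n) a e * mon e z.

(** The step by which inductions on the number of variables reach the one-variable results. *)
Lemma mpol_cons D n a x z : mpol D n.+1 a (x :: z) =
  (\poly_(k < D) mpol D n (fun e => a (k :: e)) z).[x].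
Proof.
rewrite horner_poly -(big_mkord xpredT (fun k => mpol D n (fun e => a (k :: e)) z * x ^+ k)).
rewrite /mpol /= big_allpairs_dep /=; apply: eq_bigr => k _.
rewrite mulr_suml; apply: eq_bigr => e _.
by rewrite mon_cons -mulrA [mon _ _ * _]mulrC.
Qed.

Lemma mon_scale c e z : size e = size z ->
  mon e [seq c * x | x <- z] = c ^+ sumn e * mon e z.
Proof.
elim: e z => [|k e IH] [|x z]//= => [_|[sz]]; first by rewrite /mon !big_nil mul1r.
by rewrite !mon_cons IH// exprD exprMn; ring.
Qed.

Lemma mpol_scale D n a c z (d : nat) : size z = n ->
  (forall e, sumn e != d -> a e = 0) ->
  mpol D n a [seq c * x | x <- z] = c ^+ d * mpol D n a z.
Proof.
move=> sz ad; rewrite /mpol mulr_sumr !big_seq; apply: eq_bigr => e.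
rewrite mem_expo => /andP[/eqP se _]; rewrite mon_scale ?se//.
by have [->|/ad ->] := eqVneq (sumn e) d; [ring|rewrite !mul0r mulr0].
Qed.

Lemma mon_mul e z z' : size e = size z -> size z = size z' ->
  mon e [seq p.1 * p.2 | p <- zip z z'] = mon e z * mon e z'.
Proof.
elim: e z z' => [|k e IH] [|x z] [|x' z']//= => [_ _|[sz] [sz']].
  by rewrite /mon !big_nil mul1r.
by rewrite !mon_cons IH// exprMn; ring.
Qed.

End MultivariatePolynomials.

Lemma rmorph_mon (K L : comNzRingType) (f : {rmorphism K -> L}) e (z : seq K) :
  f (mon e z) = mon e (map f z).
Proof.
elim: e z => [|k e IH] [|x z]; rewrite ?[mon _ [::]]/mon /= /mon /= ?big_nil ?rmorph1//.
by rewrite !big_cons rmorphM rmorphXn /= [X in _ * X]IH.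
Qed.

(** * Coefficient estimates and mean comparison on the torus *)

Section SeveralVariables.
Local Open Scope complex_scope.
Variable R : realType.
Implicit Types (z : seq R[i]) (a : seq nat -> R[i]) (e : seq nat) (D n : nat).

Definition torus n z := (size z == n) && all (fun x => normc x == 1) z.

Lemma torusS n x z : torus n.+1 (x :: z) = (normc x == 1) && torus n z.
Proof. by rewrite /torus /= eqSS; case: (size z == n); rewrite ?andbF ?andbT. Qed.

(** The one-variable coefficient estimate, applied to each variable in turn. *)
Lemma normc_coef_torus_le D n a (M : R) : 0 <= M ->
  (forall z, torus n z -> normc (mpol D n a z) <= M) ->
  forall e, e \in expo D n -> normc (a e) <= M.
Proof.
move=> M0; elim: n a => [|n IH] a aM e.
  rewrite inE => /eqP ->; have := aM [::] isT.
  by rewrite /mpol big_seq1 /mon big_nil mulr1.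
move=> /allpairsP[[k e'] /= []]; rewrite mem_index_iota => /andP[_ kD] he' ->.
apply: (IH (fun e => a (k :: e))) => // z hz.
have := @normc_coef_le R (\poly_(k < D) mpol D n (fun e => a (k :: e)) z) k M M0.
rewrite coef_poly kD; apply=> x x1; rewrite -mpol_cons.
by apply: aM; rewrite torusS x1 eqxx.
Qed.

Definition avg (pts : seq (seq R[i])) (F : seq R[i] -> R) : R :=
  (size pts)%:R^-1 * \sum_(z <- pts) F z.

Definition expo_wt e : R := half_pow R (sumn e).

Notation wnorm D := (l2norm (index_iota 0 D) (half_pow R)).
Notation ewnorm D n := (l2norm (expo D n) expo_wt).

Lemma ewnormS D n (x : seq nat -> R) :
  ewnorm D n.+1 x = wnorm D (fun k => ewnorm D n (fun e => x (k :: e))).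
Proof.
congr Num.sqrt; rewrite /= big_allpairs_dep /=; apply: eq_bigr => k _.
rewrite sqr_l2norm; last by move=> e; exact: half_pow_ge0.
rewrite mulr_sumr; apply: eq_bigr => e _.
by rewrite mulrA /expo_wt /half_pow /= exprD.
Qed.

(** [E3] applies the induction hypothesis to each coefficient in the first variable, [E2] moves the
    average over the points out of the norm by Minkowski's inequality, and [E1] applies the
    one-variable case at each point. The points must be common to a family, because the induction
    hypothesis is used for all pairs in [T * 'I_D] at once. *)
Lemma ewnorm_le_avg (T : finType) D n (a : T -> seq nat -> R[i]) (eps : R) :
  0 < eps -> exists pts, [/\ (0 < size pts)%N, all (torus n) pts & forall t,
    ewnorm D n (fun e => normc (a t e)) <=
      avg pts (fun z => normc (mpol D n (a t) z)) + eps].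
Proof.
elim: n T a eps => [|n IH] T a eps eps0.
  exists [:: [::]]; split => // t.
  rewrite /l2norm /avg /mpol /= !big_seq1 invr1 mul1r /mon big_nil mulr1.
  rewrite /expo_wt /half_pow expr0 mul1r sqrtr_sqr ger0_norm ?normc_ge0//.
  by rewrite lerDl ltW.
have [K KE] : exists K, K = wnorm D (fun=> 1) by eexists.
have K0 : 0 <= K by rewrite KE l2norm_ge0.
(* [E1] costs d; in [E3] an error d in every coefficient costs d K. *)
pose d := eps / (1 + K).
have d0 : 0 < d by rewrite divr_gt0//; lra.
have dK : d + d * K = eps by rewrite /d; field; lra.
clearbody d.
have [pts [p0 ptorus hp]] := IH (T * 'I_D)%type (fun tk e => a tk.1 ((tk.2 : nat) :: e)) _ d0.
pose F t z := \poly_(k < D) mpol D n (fun e => a t (k :: e)) z.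
have [N [w [hw hN]]] := @l2norm_le_avg_family R (T * 'I_(size pts))%type D
   (fun ti => F ti.1 (nth [::] pts ti.2)) _ d0.
have N0 := prim_order_gt0 hw.
exists [seq w ^+ s :: z | s <- index_iota 0 N, z <- pts]; split.
- by rewrite size_allpairs size_iota subn0 muln_gt0 N0.
- apply/allP => y /allpairsP[[s z] /= [_ zp ->]].
  by rewrite torusS normcX (normc_prim_root hw) expr1n eqxx /= (allP ptorus).
move=> t.
have s0 : 0 < (size pts)%:R :> R by rewrite ltr0n.
have sN : 0 < N%:R :> R by rewrite ltr0n.
have hz z : z \in pts -> wnorm D (fun k => normc (F t z)`_k) <=
    N%:R^-1 * \sum_(0 <= s < N) normc (F t z).[w ^+ s] + d.
  move=> zp; have zi : (index z pts < size pts)%N by rewrite index_mem.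
  by have := hN (t, Ordinal zi); rewrite /= nth_index// big_mkord.
have E : avg [seq w ^+ s :: z | s <- index_iota 0 N, z <- pts]
    (fun z => normc (mpol D n.+1 (a t) z)) =
  avg pts (fun z => N%:R^-1 * \sum_(0 <= s < N) normc (F t z).[w ^+ s]).
  rewrite /avg size_allpairs size_iota subn0 big_allpairs_dep exchange_big /=.
  rewrite natrM invfM -mulrA mulrCA -mulr_sumr; congr (_ * (_ * _)).
  by apply: eq_bigr => z _; apply: eq_bigr => s _; rewrite mpol_cons.
rewrite E ewnormS.
have E1 : avg pts (fun z => wnorm D (fun k => normc (F t z)`_k)) <=
  avg pts (fun z => N%:R^-1 * \sum_(0 <= s < N) normc (F t z).[w ^+ s]) + d.
  rewrite -(ler_pM2l s0) mulrDr /avg !mulrA divff ?gt_eqF// !mul1r.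
  have -> : (size pts)%:R * d = \sum_(z <- pts) d.
    by rewrite big_const_seq count_predT iter_addr_0 mulr_natl.
  by rewrite -big_split /= !big_seq; apply: ler_sum => z /hz.
have E2 : wnorm D (fun k => avg pts (fun z => normc (F t z)`_k)) <=
  avg pts (fun z => wnorm D (fun k => normc (F t z)`_k)).
  rewrite l2normZ ?invr_ge0 ?ler0n// ler_wpM2l ?invr_ge0 ?ler0n//.
  by apply: l2norm_sum => k; exact: half_pow_ge0.
have E3 : wnorm D (fun k => ewnorm D n (fun e => normc (a t (k :: e)))) <=
  wnorm D (fun k => avg pts (fun z => normc (F t z)`_k)) + d * K.
  rewrite KE -(l2normZ _ _ _ (ltW d0)).
  apply: le_trans (l2normD _ (half_pow_ge0 R) _ _).
  rewrite /l2norm ler_wsqrtr// !big_seq; apply: ler_sum => k.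
  rewrite mem_index_iota => /andP[_ kD].
  rewrite ler_wpM2l ?half_pow_ge0// lerXn2r ?nnegrE ?l2norm_ge0//.
    rewrite addr_ge0 ?mulr1 ?(ltW d0)// mulr_ge0 ?invr_ge0 ?ler0n//.
    by apply: sumr_ge0 => z _; exact: normc_ge0.
  rewrite mulr1 (le_trans (hp (t, Ordinal kD)))// lerD2r /avg.
  rewrite ler_wpM2l ?invr_ge0 ?ler0n//; apply: ler_sum => z _.
  by rewrite coef_poly kD.
by lra.
Qed.

End SeveralVariables.

(** * Partial derivatives *)

Lemma sumn_incr_nth e k : sumn (incr_nth e k) = (sumn e).+1.
Proof.
elim: e k => [|x e IH] [|k] //=; last by rewrite IH addnS.
by rewrite sumn_ncons.
Qed.

Lemma sum_subset_le (R : realType) (T : eqType) (X Y : seq T) (F : T -> R) :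
  uniq X -> uniq Y -> {subset X <= Y} -> (forall x, 0 <= F x) ->
  \sum_(x <- X) F x <= \sum_(x <- Y) F x.
Proof.
move=> uX uY XY F0.
rewrite (perm_big [seq y <- Y | y \in X]); last first.
  apply: uniq_perm; rewrite ?filter_uniq// => x.
  by rewrite mem_filter; case: (boolP (x \in X)) => //= /XY ->.
by rewrite big_filter [leRHS](bigID (mem X)) /= lerDl sumr_ge0.
Qed.

Section PartialDerivatives.
Variable K : comNzRingType.
Implicit Types (z w : seq K) (a : seq nat -> K) (e : seq nat) (D n : nat).

(** The coefficient of z^e in the partial derivative d_k of the polynomial with coefficients a. *)
Definition dcoef a k e : K := (nth 0%N e k).+1%:R * a (incr_nth e k).

(** The line z + t w as a tuple of polynomials in t, so that the derivative in the direction w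
    becomes the coefficient of t. *)
Definition line z w : seq {poly K} := [seq p.1%:P + p.2 *: 'X | p <- zip z w].

Definition mpol_line D n a z w := mpol D n (fun e => (a e)%:P) (line z w).

Lemma horner_mpol_line D n a z w t :
  (mpol_line D n a z w).[t] = mpol D n a [seq p.1 + t * p.2 | p <- zip z w].
Proof.
rewrite /mpol_line /mpol horner_sum; apply: eq_bigr => e _.
rewrite hornerM hornerC -[(mon _ _).[t]]/(horner_eval t (mon _ _)) rmorph_mon.
congr (_ * mon e _); rewrite -map_comp; apply: eq_map => p /=.
by rewrite /horner_eval !hornerE mulrC.
Qed.

Lemma coef01_exp_line (x y : K) k (l := (x%:P + y *: 'X) ^+ k) :
  l`_0 = x ^+ k /\ l`_1 = k%:R * x ^+ k.-1 * y.
Proof.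
have c0 : (x%:P + y *: 'X)`_0 = x by rewrite coefD coefC coefZ coefX mulr0 addr0.
have c1 : (x%:P + y *: 'X)`_1 = y by rewrite coefD coefC coefZ coefX mulr1 add0r.
rewrite {}/l; elim: k => [|k [IH0 IH1]].
  by rewrite !expr0 !coef1 !mul0r.
rewrite exprS !coefM !big_ord_recl !big_ord0 /= /bump /= subnn !subn0 IH0 IH1 c0 c1.
rewrite !addr0 exprS; split=> //; case: k {IH0 IH1} => [|k] /=; first by rewrite !expr0; ring.
by rewrite exprS -!natr1; ring.
Qed.

(* The hypothesis makes [mpol D n a] the sum over all exponents. *)
Lemma coef1_mpol_line D n a z w : size z = n -> size w = n ->
  (forall e, has (fun i => (D <= i)%N) e -> a e = 0) ->
  (mpol_line D n a z w)`_1 =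
  \sum_(0 <= k < n) nth 0 w k * mpol D n (dcoef a k) z.
Proof.
elim: n a z w => [|n IH] a [|x z] [|y w]//= => [_ _ _|[sz] [sw] aD].
  by rewrite /mpol_line /mpol /= big_seq1 big_nil /mon big_nil mulr1 coefC.
rewrite /mpol_line /= mpol_cons horner_poly coef_sum.
pose T k := mpol_line D n (fun e => a (k :: e)) z w.
pose F k := mpol D n (fun e => a (k :: e)) z.
have T0 k : (T k)`_0 = F k.
  rewrite -horner_coef0 horner_mpol_line /F; congr mpol.
  rewrite -[RHS](@unzip1_zip _ _ z w) ?sz ?sw//; apply: eq_map => p.
  by rewrite mul0r addr0.
rewrite (eq_bigr (fun k : 'I_D => F k * (k%:R * x ^+ k.-1 * y) + (T k)`_1 * x ^+ k)); last first.
  move=> k _; have [l0 l1] := coef01_exp_line x y k.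
  by rewrite coefM !big_ord_recl big_ord0 /= /bump /= subnn !subn0 -/(T k) T0 l0 l1 addr0.
rewrite big_split /= big_nat_recl//=; congr (_ + _).
  rewrite mpol_cons horner_poly mulr_sumr.
  rewrite /F {T0 T F}; case: D {IH} aD => [|D] aD; first by rewrite !big_ord0.
  (* Differentiation lowers the exponent by one: on the left the term k = 0 vanishes, and on the
     right the top term involves a first exponent out of range, where a is zero. *)
  rewrite big_ord_recl /= mul0r mul0r mulr0 add0r big_ord_recr /=.
  rewrite [X in _ + X](_ : _ = 0) ?addr0; last first.
    rewrite /mpol big1 ?mul0r ?mulr0// => e _.
    by rewrite /dcoef /= aD ?mulr0 ?mul0r//= leqnn.
  apply: eq_bigr => k _; rewrite /dcoef /= /bump /=.
  have -> : mpol D.+1 n (fun e => k.+1%:R * a (k.+1 :: e)) z =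
      k.+1%:R * mpol D.+1 n (fun e => a (k.+1 :: e)) z.
    by rewrite /mpol mulr_sumr; apply: eq_bigr => e _; rewrite mulrA.
  by rewrite add1n; ring.
transitivity (\sum_(k < D) \sum_(0 <= i < n)
    nth 0 w i * (mpol D n (dcoef (fun e => a ((k : nat) :: e)) i) z * x ^+ k)).
  apply: eq_bigr => k _; rewrite /T IH//; last first.
    by move=> e he; apply: aD; rewrite /= he orbT.
  by rewrite mulr_suml; apply: eq_bigr => i _; rewrite mulrA.
rewrite exchange_big /=; apply: eq_bigr => i _.
by rewrite -mulr_sumr mpol_cons horner_poly.
Qed.

Lemma dcoef_homog a (d k : nat) : (forall e, sumn e != d.+1 -> a e = 0) ->
  forall e, sumn e != d -> dcoef a k e = 0.
Proof.
move=> ad e ed; rewrite /dcoef ad ?mulr0// sumn_incr_nth.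
by rewrite eqSS.
Qed.

End PartialDerivatives.

(** * Cauchy's inequality for derivatives, and exponents at least two *)

Section Cauchy.
Local Open Scope complex_scope.
Variable R : realType.
Implicit Types (z w : seq R[i]) (a : seq nat -> R[i]) (e : seq nat) (D n : nat).

(** Cauchy's inequality on the circle |t| = 1/m gives the factor m; homogeneity on the ball of
    radius 1 + 1/m gives the power. *)
Definition deriv_const (m : nat) : R := m%:R * (1 + m%:R^-1) ^+ m.

(** The point z + (t/m) w divided by 1 + 1/m. It is the convex combination of z and t w with weights
    m/(m+1) and 1/(m+1), hence stays in the unit ball. *)
Definition cauchy_pt (m : nat) z w (t : R[i]) : seq R[i] :=
  [seq (1 + m%:R^-1)^-1 * (p.1 + t * (m%:R^-1 * p.2)) | p <- zip z w].

(** The directional derivative is m times the coefficient of t in P(z + t w/m). The set [B] is left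
    abstract to serve both the polydisc and the balls of ell_p. *)
Lemma deriv_le D n m a (B : seq R[i] -> Prop) (S : R) : (0 < m)%N ->
  (forall e, has (fun i => (D <= i)%N) e -> a e = 0) ->
  (forall e, sumn e != m -> a e = 0) ->
  (forall y, B y -> normc (mpol D n a y) <= S) ->
  forall z w, size z = n -> size w = n ->
  (forall t, normc t = 1 -> B (cauchy_pt m z w t)) ->
  normc (\sum_(0 <= k < n) nth 0 w k * mpol D n (dcoef a k) z) <= deriv_const m * S.
Proof.
move=> m0 aD am BS z w sz sw Bzw.
have m00 : 0 < m%:R :> R by rewrite ltr0n.
have mC : m%:R != 0 :> R[i] by rewrite pnatr_eq0 -lt0n.
pose w' := [seq m%:R^-1 * x | x <- w].
have sw' : size w' = n by rewrite size_map.
have S0 : 0 <= S := le_trans (normc_ge0 _) (BS _ (Bzw 1 (normc1 R))).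
have c0 : 0 <= (1 + m%:R^-1) ^+ m * S by rewrite mulr_ge0// exprn_ge0// addr_ge0 ?invr_ge0.
have cE : 1 + m%:R^-1 = ((1 + m%:R^-1 : R)%:C) :> R[i].
  by rewrite rmorphD rmorph1 fmorphV rmorph_nat.
have nc : normc (1 + m%:R^-1 : R[i]) = 1 + m%:R^-1.
  by rewrite cE normc_real// addr_ge0 ?invr_ge0// ltW.
have cn0 : 1 + m%:R^-1 != 0 :> R[i].
  by rewrite -normc_eq0 nc gt_eqF// addr_gt0 ?invr_gt0.
have key : normc (mpol_line D n a z w')`_1 <= (1 + m%:R^-1) ^+ m * S.
  apply: normc_coef_le => // t t1; rewrite horner_mpol_line.
  have -> : [seq p.1 + t * p.2 | p <- zip z w'] =
      [seq (1 + m%:R^-1) * x | x <- cauchy_pt m z w t].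
    rewrite /w' /cauchy_pt; elim: (z) (w) => [|x s IH] [|y s'] //=.
    by rewrite IH mulrA divff// mul1r.
  rewrite (mpol_scale _ _ _ am) ?size_map ?size_zip ?sz ?sw ?minnn//.
  rewrite normcM normcX nc; apply: ler_wpM2l; last exact/BS/Bzw.
  by rewrite exprn_ge0 ?addr_ge0 ?invr_ge0 ?(ltW m00).
rewrite coef1_mpol_line// in key.
have -> : \sum_(0 <= k < n) nth 0 w k * mpol D n (dcoef a k) z =
   m%:R * \sum_(0 <= k < n) nth 0 w' k * mpol D n (dcoef a k) z.
  rewrite mulr_sumr; apply: eq_big_nat => k /andP[_ kn].
  by rewrite (nth_map 0) ?sw// !mulrA divff// mul1r.
by rewrite normcM normc_nat /deriv_const -mulrA ler_wpM2l.
Qed.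

(** The direction consists of the phases that turn each d_k P(z) into its modulus. *)
Lemma sum_normc_deriv_torus_le D n m a (S : R) : (0 < m)%N ->
  (forall e, has (fun i => (D <= i)%N) e -> a e = 0) ->
  (forall e, sumn e != m -> a e = 0) ->
  (forall y, size y = n -> all (fun x => normc x <= 1) y ->
     normc (mpol D n a y) <= S) ->
  forall z, torus n z ->
  \sum_(0 <= k < n) normc (mpol D n (dcoef a k) z) <= deriv_const m * S.
Proof.
move=> m0 aD am aS z /andP[/eqP sz z1].
have [th hth] : exists th : nat -> R[i], forall k, normc (th k) = 1 /\
    th k * mpol D n (dcoef a k) z = (normc (mpol D n (dcoef a k) z))%:C.
  have /boolp.choice[th hth] : forall k, exists t, normc t = 1 /\
      t * mpol D n (dcoef a k) z = (normc (mpol D n (dcoef a k) z))%:C.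
    by move=> k; have [t t1 tE] := exists_phase (mpol D n (dcoef a k) z); exists t.
  by exists th.
have := @deriv_le D n m a (fun y => size y = n /\ all (fun x => normc x <= 1) y)
  S m0 aD am _ z (mkseq th n) sz (size_mkseq _ _).
move=> /(_ (fun y => fun H => aS y H.1 H.2)) => H.
have {}H := H _; set X := \sum_(0 <= k < n) _ in H.
have XE : X = (\sum_(0 <= k < n) normc (mpol D n (dcoef a k) z))%:C.
  rewrite rmorph_sum /=; apply: eq_big_nat => k /andP[_ kn].
  by rewrite nth_mkseq// (hth k).2.
rewrite -[leLHS]normc_real -?XE; last by apply: sumr_ge0 => k _; exact: normc_ge0.
apply: H => t t1; split; first by rewrite size_map size_zip size_mkseq sz minnn.
apply/allP => _ /mapP[[x y] /= xy ->].
have xz : x \in z.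
  by have := map_f fst xy; rewrite -/(unzip1 _) unzip1_zip// size_mkseq sz.
have yw : y \in mkseq th n.
  by have := map_f snd xy; rewrite -/(unzip2 _) unzip2_zip// size_mkseq sz.
have nx : normc x = 1 by apply/eqP; apply: (allP z1).
have ny : normc y = 1 by move: yw => /mapP[k _ ->]; exact: (hth k).1.
have m00 : 0 < m%:R :> R by rewrite ltr0n.
have c0 : 0 < 1 + m%:R^-1 :> R by rewrite addr_gt0 ?invr_gt0.
have -> : 1 + m%:R^-1 = ((1 + m%:R^-1 : R)%:C) :> R[i].
  by rewrite rmorphD rmorph1 fmorphV rmorph_nat.
rewrite normcM normcV normc_real ?(ltW c0)// ler_pdivrMl// mulr1.
rewrite (le_trans (ler_normcD _ _))// !normcM nx ny t1 normcV normc_nat.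
by rewrite mul1r mulr1.
Qed.

(** Each d_k P is homogeneous of degree m, so the weights reduce to the constant 2^(-m). The points
    are common to all k, so the sum of the averages is the average of a sum that is bounded
    pointwise. *)
Lemma sum_l2norm_deriv_le D n m a (S : R) :
  (forall e, has (fun i => (D <= i)%N) e -> a e = 0) ->
  (forall e, sumn e != m.+1 -> a e = 0) ->
  (forall y, size y = n -> all (fun x => normc x <= 1) y ->
     normc (mpol D n a y) <= S) ->
  \sum_(0 <= k < n) Num.sqrt (\sum_(e <- expo D n) normc (dcoef a k e) ^+ 2)
    <= Num.sqrt 2 ^+ m * (deriv_const m.+1 * S).
Proof.
move=> aD am aS.
have E k : l2norm (expo D n) (@expo_wt R) (fun e => normc (dcoef a k e)) =
    (Num.sqrt 2)^-1 ^+ m * Num.sqrt (\sum_(e <- expo D n) normc (dcoef a k e) ^+ 2).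
  rewrite /l2norm -(_ : Num.sqrt (2^-1 ^+ m) = (Num.sqrt 2)^-1 ^+ m); last first.
    rewrite -sqrtrV//; elim: (m) => [|i IH]; first by rewrite !expr0 sqrtr1.
    by rewrite !exprS sqrtrM ?invr_ge0// IH.
  rewrite -sqrtrM ?exprn_ge0 ?invr_ge0//; congr Num.sqrt; rewrite mulr_sumr.
  apply: eq_bigr => e _; have [se|se] := eqVneq (sumn e) m.
    by rewrite /expo_wt /half_pow se.
  by rewrite (dcoef_homog k am se) (normc0 R) expr0n !mulr0.
have key : \sum_(0 <= k < n) l2norm (expo D n) (@expo_wt R) (fun e => normc (dcoef a k e))
    <= deriv_const m.+1 * S.
  apply/ler_addgt0Pr => eps eps0.
  (* The n errors add up to at most eps; n + 1 keeps the divisor positive when n = 0. *)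
  have d0 : 0 < eps / n.+1%:R by rewrite divr_gt0 ?ltr0n.
  have [pts [p0 /allP ptor hp]] := @ewnorm_le_avg R 'I_n D n (fun k => dcoef a k) _ d0.
  have s0 : 0 < (size pts)%:R :> R by rewrite ltr0n.
  rewrite big_mkord.
  apply: le_trans (_ : \sum_(k < n) (avg pts (fun z => normc (mpol D n (dcoef a k) z))
     + eps / n.+1%:R) <= _).
    by apply: ler_sum => k _; apply: hp.
  rewrite big_split /= lerD//; last first.
    rewrite sumr_const card_ord -[leLHS]mulr_natl mulrCA ger_pMr// ler_pdivrMr ?ltr0n//.
    by rewrite mul1r ler_nat.
  rewrite /avg -mulr_sumr exchange_big /= ler_pdivrMl//.
  have -> : (size pts)%:R * (deriv_const m.+1 * S) =
      \sum_(z <- pts) (deriv_const m.+1 * S).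
    by rewrite big_const_seq count_predT iter_addr_0 mulr_natl.
  rewrite !big_seq; apply: ler_sum => z /ptor zt.
  rewrite -(big_mkord xpredT (fun k => normc (mpol D n (dcoef a k) z))).
  exact: sum_normc_deriv_torus_le.
rewrite (eq_bigr _ (fun k _ => E k)) -mulr_sumr in key.
have s2 : 0 < Num.sqrt 2 :> R by rewrite sqrtr_gt0.
by move: key; rewrite exprVn ler_pdivrMl ?exprn_gt0.
Qed.

(** Cauchy-Schwarz over [X] against the constant 1, separately for each k. *)
Lemma sum_deriv_coef_le D n m a (S : R) (X : seq (seq nat)) :
  (forall e, has (fun i => (D <= i)%N) e -> a e = 0) ->
  (forall e, sumn e != m.+1 -> a e = 0) ->
  (forall y, size y = n -> all (fun x => normc x <= 1) y ->
     normc (mpol D n a y) <= S) ->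
  uniq X -> {subset X <= expo D n} ->
  \sum_(e <- X) \sum_(0 <= k < n) normc (dcoef a k e) <=
   Num.sqrt (size X)%:R * (Num.sqrt 2 ^+ m * (deriv_const m.+1 * S)).
Proof.
move=> aD am aS uX XD; rewrite exchange_big /=.
apply: le_trans (ler_wpM2l (sqrtr_ge0 _) (sum_l2norm_deriv_le aD am aS)).
rewrite mulr_sumr; apply: ler_sum => k _.
have w0 (e : seq nat) : 0 <= (fun=> 1 : R) e by [].
have := l2norm_CS X w0 (fun=> 1) (fun e => normc (dcoef a k e)).
rewrite (eq_bigr (fun e => normc (dcoef a k e))) => [|e _]; last by rewrite !mul1r.
move=> /le_trans; apply; rewrite /l2norm.
rewrite (_ : \sum_(_ <- X) _ = (size X)%:R); last first.
  by rewrite expr1n mulr1 big_const_seq count_predT iter_addr_0.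
rewrite ler_wpM2l ?sqrtr_ge0// ler_wsqrtr//.
rewrite (eq_bigr (fun e => normc (dcoef a k e) ^+ 2)) => [|e _]; last by rewrite mul1r.
by apply: sum_subset_le => // [|e]; rewrite ?uniq_expo ?sqr_ge0.
Qed.

End Cauchy.

(** * Exponents at most two *)

Section RealInequalities.
Variable R : realType.
Implicit Types (p x y t : R).

Lemma sum_exp_coeff_le x D : 0 <= x ->
  \sum_(0 <= k < D) x ^+ k / k`!%:R <= expR x.
Proof.
move=> x0; rewrite -[leLHS]/(series (exp_coeff x) D).
apply: nondecreasing_cvgn_le; last exact: is_cvg_series_exp_coeff.
apply: nondecreasing_series => n _ _; exact: exp_coeff_ge0.
Qed.

Lemma convex_powR_le p t x y : 1 <= p -> 0 <= t <= 1 -> 0 <= x -> 0 <= y ->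
  (t * x + (1 - t) * y) `^ p <= t * x `^ p + (1 - t) * y `^ p.
Proof.
move=> p1 /andP[t0 t1] x0 y0.
have /(_ x y) := convex_powR p1 (Itv01 t0 t1).
by rewrite !inE /= !in_itv /= !andbT !convRE /=; apply.
Qed.

Lemma powR_inv x p : 0 <= x -> x^-1 `^ p = (x `^ p)^-1.
Proof. by move=> x0; rewrite -powR_inv1// -powRrM mulN1r powRN. Qed.

(** The tangent to x^p at 1 lies below the graph; this is Young's inequality with second factor
    1. *)
Lemma powR_tangent p x : 1 <= p -> 0 <= x -> x <= p^-1 * x `^ p + (1 - p^-1).
Proof.
rewrite le_eqVlt => /predU1P[<- x0|p1 x0].
  by rewrite invr1 powRr1// mul1r subrr addr0.
have p0 : 0 < p by lra.
have q0 : 0 < 1 - p^-1 by rewrite subr_gt0 invf_lt1.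
have := @conjugate_powR R x 1 p (1 - p^-1)^-1 x0 ler01 p0.
rewrite invr_gt0 invrK => /(_ q0).
rewrite ?invrK mulr1 powR1 mul1r (mulrC _ p^-1); apply; ring.
Qed.

(** Hölder's inequality against the constant 1, from the tangent inequality rescaled to touch at v,
    the common value of the y_i when their p-th powers are equal and sum to [B]. *)
Lemma sum_le_powR (I : Type) (s : seq I) (y : I -> R) p (B : R) : 1 <= p -> 0 < B ->
  (forall i, 0 <= y i) -> \sum_(i <- s) y i `^ p <= B ->
  \sum_(i <- s) y i <= (size s)%:R `^ (1 - p^-1) * B `^ p^-1.
Proof.
move=> p1 B0 y0 yB; have p0 : 0 < p by lra.
have [s0|s0] := posnP (size s).
  by move/size0nil: s0 => ->; rewrite big_nil mulr_ge0// powR_ge0.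
have N0 : 0 < (size s)%:R :> R by rewrite ltr0n.
pose v := (B / (size s)%:R) `^ p^-1.
have v0 : 0 < v by rewrite powR_gt0// divr_gt0.
have vp : v `^ p = B / (size s)%:R.
  by rewrite /v -powRrM mulVf ?gt_eqF// powRr1// ltW// divr_gt0.
have tan i : y i <= v * (p^-1 * (y i `^ p / (v `^ p)) + (1 - p^-1)).
  rewrite -ler_pdivrMl// mulrC.
  have -> : y i `^ p / v `^ p = (y i / v) `^ p.
    by rewrite powRM ?invr_ge0 ?powR_inv// ltW.
  by apply: powR_tangent => //; rewrite divr_ge0// ltW.
apply: le_trans (ler_sum _ (fun i _ => tan i)) _.
rewrite -mulr_sumr big_split /= -mulr_sumr -mulr_suml.
rewrite big_const_seq count_predT iter_addr_0 -[_ *+ size s]mulr_natl.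
have -> : (size s)%:R `^ (1 - p^-1) * B `^ p^-1 = v * (size s)%:R.
  rewrite /v powRM ?invr_ge0 ?(ltW B0) ?ler0n// powRB ?(gt_eqF N0) ?implybT//.
  by rewrite powRr1 ?ler0n// powR_inv ?ler0n//; ring.
rewrite ler_pM2l// vp invf_div.
have : (\sum_(i <- s) y i `^ p) * ((size s)%:R / B) <= (size s)%:R.
  by rewrite mulrCA ger_pMr// ler_pdivrMr// mul1r.
have : 0 < p^-1 by rewrite invr_gt0.
set S := _ * (_ / B); move=> pi0 hS.
have : p^-1 * S <= p^-1 * (size s)%:R by rewrite ler_pM2l.
lra.
Qed.

End RealInequalities.

(** * Derivative coefficients on the balls of ell_p *)

Section SmallExponent.
Local Open Scope complex_scope.
Variable R : realType.
Implicit Types (z w u : seq R[i]) (a : seq nat -> R[i]) (e : seq nat) (D n : nat).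

Definition psum (p : R) z : R := \sum_(x <- z) normc x `^ p.

(** Convexity of x^p, with the weights l and 1 - l of the convex combination [cauchy_pt]. *)
Lemma psum_cauchy_pt p m z w t : 1 <= p -> (0 < m)%N -> size z = size w ->
  normc t = 1 -> psum p z <= 1 -> psum p w <= 1 -> psum p (cauchy_pt m z w t) <= 1.
Proof.
move=> p1 m0 szw t1.
have m00 : 0 < m%:R :> R by rewrite ltr0n.
pose l : R := (1 + m%:R^-1)^-1.
have mi : 0 < m%:R^-1 :> R by rewrite invr_gt0.
have l0 : 0 < l by rewrite invr_gt0; lra.
have l1 : l <= 1 by rewrite invf_le1; lra.
have lm : l * m%:R^-1 = 1 - l by rewrite /l; field; lra.
have cE : (1 + m%:R^-1)^-1 = l%:C :> R[i].
  by rewrite fmorphV rmorphD rmorph1 fmorphV rmorph_nat.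
suff H : psum p (cauchy_pt m z w t) <= l * psum p z + (1 - l) * psum p w by nra.
rewrite /psum /cauchy_pt big_map cE.
elim: z w szw => [|x z IH] [|y w]//= => [_|[szw]].
  by rewrite !big_nil !mulr0 addr0.
rewrite !big_cons /=.
suff : normc (l%:C * (x + t * (m%:R^-1 * y))) `^ p <=
    l * normc x `^ p + (1 - l) * normc y `^ p by move: (IH _ szw); lra.
apply: le_trans (convex_powR_le p1 _ (normc_ge0 x) (normc_ge0 y)); last by rewrite l1 ltW.
rewrite ge0_ler_powR ?nnegrE ?normc_ge0//; first by lra.
  by rewrite addr_ge0 ?mulr_ge0 ?normc_ge0 ?(ltW l0) ?subr_ge0.
rewrite normcM normc_real ?(ltW l0)// -lm -mulrA -mulrDr ler_pM2l//.
by rewrite (le_trans (ler_normcD _ _))// !normcM t1 mul1r normcV normc_nat.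
Qed.

(** For |e| = m > 0 these radii lie on the unit sphere of ell_p, where they maximize the monomial
    z^e. *)
Definition radii p (m : nat) e : seq R := [seq (i%:R / m%:R) `^ p^-1 | i <- e].

Lemma mon_real_ge0 e (xs : seq R) : all (fun x => 0 <= x) xs -> 0 <= mon e xs.
Proof.
elim: e xs => [|k e IH] [|x xs] /=; rewrite ?/mon ?big_nil//.
by move=> /andP[x0 h]; rewrite big_cons mulr_ge0 ?exprn_ge0//; exact: IH.
Qed.

Lemma normc_mon e z : normc (mon e z) = mon e (map (@normc R) z).
Proof.
elim: e z => [|k e IH] [|x z]; rewrite /mon /= ?big_nil ?(normc1 R)//.
by rewrite !big_cons normcM normcX [X in _ * X]IH.
Qed.

(** A zero entry of e has radius 0 but exponent 0, and contributes the factor 1. *)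
Lemma mon_radii_gt0 p m e : (0 < m)%N -> 0 < mon e (radii p m e).
Proof.
move=> m0; elim: e => [|k e IH]; rewrite /mon /= ?big_nil// big_cons mulr_gt0//=.
case: k => [|k]; first by rewrite expr0.
by rewrite exprn_gt0// powR_gt0// divr_gt0// ltr0n.
Qed.

Lemma mon_degree0 m e (xs : seq R) : (forall i, i \in e -> (i <= m)%N) -> m = 0%N ->
  mon e xs = 1.
Proof.
move=> em m0; elim: e xs em => [|k e IH] [|x xs] em; rewrite /mon /= ?big_nil//.
rewrite big_cons /= (_ : k = 0%N) ?expr0 ?mul1r.
  by apply: IH => i ie; apply: em; rewrite inE ie orbT.
by apply/eqP; rewrite -leqn0 -m0 em// inE eqxx.
Qed.

Lemma fact_le_expn k : (k`! <= k ^ k)%N.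
Proof.
elim: k => [//|[//|k] IH]; rewrite factS expnS leq_mul//.
by rewrite (leq_trans IH)// leq_exp2r.
Qed.

(** The left side is the product of the (m |u_i|^p / e_i)^(e_i), and e_i! <= e_i^(e_i). *)
Lemma powR_mon_radii_le p (m : nat) e u : 0 < p -> (forall i, i \in e -> (i <= m)%N) ->
  size e = size u ->
  (normc (mon e u) / mon e (radii p m e)) `^ p <=
  \prod_(q <- zip e u) ((m%:R * normc q.2 `^ p) ^+ q.1 / q.1`!%:R).
Proof.
move=> p0; elim: e u => [|i e IH] [|x u]//= em => [_|[sz]].
  by rewrite /mon /= !big_nil (normc1 R) divr1 powR1.
have rad0 : all (fun x => 0 <= x) (radii p m e).
  by apply/allP => _ /mapP[j _ ->]; exact: powR_ge0.
rewrite !mon_cons big_cons normcM normcX invfM mulrACA.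
have nx := normc_ge0 x.
rewrite powRM; last 2 first.
- by rewrite divr_ge0 ?exprn_ge0// powR_ge0.
- by rewrite divr_ge0 ?normc_ge0// mon_real_ge0.
apply: ler_pM; rewrite ?powR_ge0//; last first.
  by apply: IH => // j je; apply: em; rewrite inE je orbT.
have : (i <= m)%N by apply: em; rewrite inE eqxx.
case: i {em} => [|i] im; first by rewrite !expr0 !divr1 powR1.
have m0 : 0 < m%:R :> R by rewrite ltr0n (leq_ltn_trans _ im).
have i0 : 0 < i.+1%:R :> R by rewrite ltr0n.
set r := _ `^ p^-1; have r0 : 0 < r by rewrite powR_gt0// divr_gt0.
have rp : r `^ p = i.+1%:R / m%:R.
  by rewrite /r -powRrM mulVf ?gt_eqF// powRr1// ltW// divr_gt0.
have -> : (normc x ^+ i.+1 / r ^+ i.+1) `^ p = (normc x `^ p * r^-1 `^ p) ^+ i.+1.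
  have xr : 0 <= normc x / r by rewrite divr_ge0// ltW.
  rewrite -expr_div_n -(powR_mulrn _ xr) powRAC powR_mulrn ?powR_ge0//.
  by rewrite powRM ?invr_ge0 ?(ltW r0).
have -> : r^-1 `^ p = m%:R / i.+1%:R.
  by rewrite powR_inv ?(ltW r0)// rp invf_div.
rewrite (_ : _ * _ = m%:R * normc x `^ p / i.+1%:R); last by ring.
rewrite expr_div_n ler_wpM2l//; first by rewrite exprn_ge0// mulr_ge0 ?powR_ge0// ltW.
by rewrite lef_pV2 ?posrE ?exprn_gt0 ?ltr0n ?fact_gt0// -natrX ler_nat fact_le_expn.
Qed.

(** The sum factors over the variables into partial sums of the series of exp(m |u_i|^p). *)
Lemma sum_prod_exp_le D n (p : R) m u : size u = n ->
  \sum_(e <- expo D n) \prod_(q <- zip e u) ((m%:R * normc q.2 `^ p) ^+ q.1 / q.1`!%:R)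
  <= expR (m%:R * psum p u).
Proof.
elim: n u => [|n IH] [|x u]//= => [_|[sz]].
  by rewrite big_seq1 big_nil /psum big_nil mulr0 expR0.
rewrite big_allpairs_dep /= /psum big_cons mulrDr expRD.
under eq_bigr do under eq_bigr do rewrite big_cons /=.
under eq_bigr do rewrite -mulr_sumr.
rewrite -mulr_suml ler_pM//; last exact: IH.
- by apply: sumr_ge0 => k _; rewrite divr_ge0 ?exprn_ge0 ?mulr_ge0 ?powR_ge0.
- apply: sumr_ge0 => e _; apply: prodr_ge0 => q _.
  by rewrite divr_ge0 ?exprn_ge0 ?mulr_ge0 ?powR_ge0.
- by apply: sum_exp_coeff_le; rewrite mulr_ge0 ?powR_ge0.
Qed.

(** The direction w has the moduli of u and phases chosen for this e, so that the terms of the e-th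
    coefficient of sum_k w_k d_k P add up without cancellation. The coefficient estimate is then
    applied on the torus with radii [radii p m e]. *)
Lemma deriv_coef_radii_le D n m a (p S : R) u e : 1 <= p ->
  (forall e, has (fun i => (D <= i)%N) e -> a e = 0) ->
  (forall e, sumn e != m.+1 -> a e = 0) ->
  (forall y, size y = n -> psum p y <= 1 -> normc (mpol D n a y) <= S) ->
  size u = n -> psum p u <= 1 -> e \in expo D n -> sumn e = m ->
  (\sum_(0 <= k < n) normc (nth 0 u k) * normc (dcoef a k e)) * mon e (radii p m e)
    <= deriv_const R m.+1 * S.
Proof.
move=> p1 aD am aS su u1 eD se; have p0 : 0 < p by lra.
have szE : size e = n by move: eD; rewrite mem_expo => /andP[/eqP].
have /boolp.choice[th hth] : forall k, exists t, normc t = 1 /\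
    t * dcoef a k e = (normc (dcoef a k e))%:C.
  by move=> k; have [t t1 tE] := exists_phase (dcoef a k e); exists t.
pose w := mkseq (fun k => th k * (normc (nth 0 u k))%:C) n.
have sw : size w = n by rewrite size_mkseq.
have w1 : psum p w <= 1.
  move: u1; rewrite /psum (big_nth 0) su [in X in _ -> X](big_nth 0) sw.
  congr (_ <= _); apply: eq_big_nat => k /andP[_ kn]; rewrite nth_mkseq//.
  by rewrite normcM (hth k).1 mul1r normc_real ?normc_ge0.
pose b e' := \sum_(0 <= k < n) nth 0 w k * dcoef a k e'.
have bE z : mpol D n b z = \sum_(0 <= k < n) nth 0 w k * mpol D n (dcoef a k) z.
  rewrite /mpol; under [RHS]eq_bigr do rewrite mulr_sumr.
  rewrite exchange_big /=; apply: eq_bigr => e' _; rewrite mulr_suml.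
  by apply: eq_bigr => k _; exact/esym/mulrA.
pose rad := map (real_complex R) (radii p m e).
have srad : size rad = n by rewrite !size_map.
have psr : psum p rad <= 1.
  rewrite /psum !big_map.
  rewrite (eq_bigr (fun i : nat => i%:R / m%:R)) => [|i _]; last first.
    by rewrite normc_real ?powR_ge0// -powRrM mulVf ?gt_eqF// powRr1 ?divr_ge0.
  rewrite -mulr_suml -natr_sum -sumnE se.
  (* The sum of the p-th powers is m/m: it is 1 for m > 0, and 0 for m = 0. *)
  by have [->|m0] := posnP m; [rewrite mul0r|rewrite divff// pnatr_eq0 -lt0n].
have S0 : 0 <= S := le_trans (normc_ge0 _) (aS _ srad psr).
have dc0 : 0 <= deriv_const R m.+1 * S.
  by rewrite mulr_ge0// /deriv_const mulr_ge0// exprn_ge0// addr_ge0// invr_ge0.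
have nb : normc (b e * mon e rad) <= deriv_const R m.+1 * S.
  apply: (@normc_coef_torus_le R D n (fun e' => b e' * mon e' rad)) => //.
  move=> z /andP[/eqP sz z1].
  have -> : mpol D n (fun e' => b e' * mon e' rad) z =
      mpol D n b [seq q.1 * q.2 | q <- zip rad z].
    rewrite /mpol !big_seq; apply: eq_bigr => e'; rewrite mem_expo => /andP[/eqP se' _].
    by rewrite mon_mul ?srad ?sz// mulrA.
  rewrite bE; set y := [seq _ | _ <- _].
  have sy : size y = n by rewrite size_map size_zip srad sz minnn.
  have py : psum p y <= 1.
    rewrite (le_trans _ psr)// /psum /y big_map.
    elim: (rad) (z) z1 => [|x s IH] [|x' s'] /=; rewrite ?big_nil//.
      by move=> _; apply: sumr_ge0 => i _; apply: powR_ge0.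
    by move=> /andP[/eqP x1 /IH h]; rewrite !big_cons /= normcM x1 mulr1 lerD2l.
  apply: (@deriv_le R D n m.+1 a (fun y => size y = n /\ psum p y <= 1)) => //.
    by move=> ? [? ?]; exact: aS.
  move=> t t1; split; first by rewrite size_map size_zip sy sw minnn.
  by apply: psum_cauchy_pt; rewrite ?sy ?sw.
have be : b e = (\sum_(0 <= k < n) normc (nth 0 u k) * normc (dcoef a k e))%:C.
  rewrite rmorph_sum /=; apply: eq_big_nat => k /andP[_ kn]; rewrite nth_mkseq//.
  by rewrite rmorphM /= mulrAC (hth k).2 mulrC.
move: nb; rewrite normcM be normc_real; last first.
  by apply: sumr_ge0 => k _; rewrite mulr_ge0 ?normc_ge0.
rewrite normc_mon /rad -map_comp (_ : map _ _ = radii p m e)//.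
rewrite -[RHS]map_id; apply/eq_in_map => _ /mapP[i _ ->].
by rewrite [LHS]normc_real// powR_ge0.
Qed.

(** Write |u^e| as y_e times the monomial at [radii p m e]. The second factor together with the
    inner sum is bounded by [deriv_coef_radii_le]; the sum of the y_e is bounded by Hölder's
    inequality, as that of the y_e^p is at most exp(m). *)
Lemma sum_deriv_coef_small_le D n m a (p S : R) u (X : seq (seq nat)) : 1 <= p ->
  (forall e, has (fun i => (D <= i)%N) e -> a e = 0) ->
  (forall e, sumn e != m.+1 -> a e = 0) ->
  (forall y, size y = n -> psum p y <= 1 -> normc (mpol D n a y) <= S) ->
  size u = n -> psum p u <= 1 -> uniq X -> {subset X <= expo D n} ->
  (forall e, e \in X -> sumn e = m) ->
  \sum_(e <- X) normc (mon e u) *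
     \sum_(0 <= k < n) normc (nth 0 u k) * normc (dcoef a k e) <=
  (size X)%:R `^ (1 - p^-1) * expR (m%:R / p) * (deriv_const R m.+1 * S).
Proof.
move=> p1 aD am aS su u1 uX XD Xm; have p0 : 0 < p by lra.
have S0 : 0 <= S by rewrite (le_trans (normc_ge0 _) (aS _ su u1)).
have dc0 : 0 <= deriv_const R m.+1 * S.
  by rewrite mulr_ge0// /deriv_const mulr_ge0// exprn_ge0// addr_ge0// invr_ge0.
have eX e : e \in X -> forall i, i \in e -> (i <= m)%N.
  move=> /Xm <- i; elim: e => //= k e IH; rewrite inE => /predU1P[->|/IH].
    exact: leq_addr.
  by move=> h; rewrite (leq_trans h)// leq_addl.
have rad0 e : e \in X -> 0 < mon e (radii p m e).
  move=> he; have [m0|m0] := posnP m; last exact: mon_radii_gt0.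
  by rewrite (mon_degree0 _ (eX e he) m0).
have rad00 e : 0 <= mon e (radii p m e).
  by apply: mon_real_ge0; apply/allP => _ /mapP[j _ ->]; exact: powR_ge0.
pose y e := normc (mon e u) / mon e (radii p m e).
have y0 e : 0 <= y e by rewrite divr_ge0 ?normc_ge0.
apply: le_trans (_ : \sum_(e <- X) y e * (deriv_const R m.+1 * S) <= _).
  rewrite !big_seq; apply: ler_sum => e he.
  rewrite /y -mulrA ler_wpM2l ?normc_ge0// ler_pdivlMl ?rad0// mulrC.
  exact: deriv_coef_radii_le p1 aD am aS su u1 (XD _ he) (Xm _ he).
rewrite -mulr_suml ler_wpM2r// expRM; apply: sum_le_powR => //.
pose G e := \prod_(q <- zip e u) ((m%:R * normc q.2 `^ p) ^+ q.1 / q.1`!%:R).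
have G0 e : 0 <= G e.
  by apply: prodr_ge0 => q _; rewrite divr_ge0 ?exprn_ge0 ?mulr_ge0 ?powR_ge0.
apply: le_trans (_ : \sum_(e <- X) G e <= _).
  rewrite !big_seq; apply: ler_sum => e he; apply: powR_mon_radii_le => //.
    exact: eX.
  by have := XD _ he; rewrite mem_expo su => /andP[/eqP].
apply: le_trans (_ : \sum_(e <- expo D n) G e <= _).
  by apply: sum_subset_le; rewrite ?uniq_expo.
apply: le_trans (sum_prod_exp_le D p m su) _.
by rewrite ler_expR -[leRHS]mulr1 ler_wpM2l.
Qed.

End SmallExponent.

(** * Indices and sequence norms *)

Section Exponents.
Implicit Types (j : seq nat) (n m k : nat).

Definition expof n j : seq nat := mkseq (fun i => count_mem i j) n.

Lemma size_expof n j : size (expof n j) = n.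
Proof. exact: size_mkseq. Qed.

Lemma sumn_expof n j : all (fun k => (k < n)%N) j -> sumn (expof n j) = size j.
Proof.
move=> jn; rewrite sumnE big_map.
elim: j jn => [_|k j IH /= /andP[kn jn]]; first by rewrite big1.
rewrite big_split /= IH// -add1n; congr (_ + _)%N.
rewrite (bigD1_seq k) ?iota_uniq//= ?mem_iota//= eqxx big1 ?addn0// => i ik.
by rewrite eq_sym (negbTE ik).
Qed.

Lemma mon_expof (K : comNzRingType) n j (u : nat -> K) :
  all (fun k => (k < n)%N) j -> mon (expof n j) (mkseq u n) = \prod_(k <- j) u k.
Proof.
move=> jn; rewrite /mon /expof /mkseq zip_map big_map /=.
elim: j jn => [_|k j IH /= /andP[kn jn]].
  by rewrite big_nil big1// => i _; rewrite expr0.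
rewrite big_cons -IH//.
under eq_bigr do rewrite exprD.
rewrite big_split /=; congr (_ * _).
rewrite (bigD1_seq k) ?iota_uniq//= ?mem_iota//= eqxx expr1 big1 ?mulr1// => i ik.
by rewrite eq_sym (negbTE ik) expr0.
Qed.

Lemma expof_rcons n j k : (k < n)%N -> expof n (rcons j k) = incr_nth (expof n j) k.
Proof.
move=> kn; have s : size (incr_nth (expof n j) k) = n.
  by rewrite size_incr_nth size_expof kn.
apply: (@eq_from_nth _ 0%N); rewrite ?s ?size_expof// => i ilt.
rewrite nth_incr_nth !nth_mkseq// -cats1 count_cat /= addn0 addnC.
by rewrite eq_sym.
Qed.

(** A sorted sequence is determined by its multiplicities. *)
Lemma expof_inj n j j' : sorted leq j -> sorted leq j' ->
  all (fun k => (k < n)%N) j -> all (fun k => (k < n)%N) j' ->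
  expof n j = expof n j' -> j = j'.
Proof.
move=> sj sj' /allP jn /allP j'n E; apply: (sorted_eq leq_trans anti_leq) => //.
apply/allP => x; rewrite mem_cat => /orP xjj'.
have xn : (x < n)%N by case: xjj' => [/jn|/j'n].
by have /eqP := congr1 (fun s => nth 0%N s x) E; rewrite !nth_mkseq.
Qed.

Lemma expof_expo d n j D : Jidx_le d n j -> (d < D)%N -> expof n j \in expo D n.
Proof.
move=> [[sj _] _] dD; rewrite mem_expo size_expof eqxx /=.
apply/allP => _ /mapP[i _ ->]; apply: leq_ltn_trans dD.
by rewrite -sj count_size.
Qed.

Lemma Jidx_le_reduced m n (J : set (seq nat)) :
  J `<=` Jidx_le m.+1 n -> reduced m.+1 J `<=` Jidx_le m n.
Proof.
move=> JJ j [[sj lj] [k /JJ [_]]]; rewrite all_rcons => /andP[_ jn].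
by split.
Qed.

(** Splitting off the last entry embeds J into the product of its reduced set with 0, ..., n - 1,
    and [G] is nonnegative on the rest of that product. *)
Lemma sum_reduced_le (R : realType) m n (J : set (seq nat))
    (F : seq nat -> R) (G : seq nat -> nat -> R) :
  J `<=` Jidx_le m.+1 n -> (forall j k, 0 <= G j k) ->
  (forall j k, J (rcons j k) -> F (rcons j k) <= G j k) ->
  \sum_(j <- fset_set J) F j <=
  \sum_(j <- fset_set (reduced m.+1 J)) \sum_(0 <= k < n) G j k.
Proof.
move=> JJ G0 FG.
have fJ : finite_set J := sub_finite_set JJ (finite_Jidx_le m.+1 n).
have fR := finite_reduced m.+1 fJ.
pose f j := (take m j, last 0%N j).
have rc j : J j -> rcons (take m j) (last 0%N j) = j.
  move=> /JJ [[sj _] _]; case/lastP: j sj => // s x.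
  by rewrite size_rcons => -[sx]; rewrite last_rcons; congr rcons; rewrite -cats1 take_size_cat.
apply: le_trans (_ : \sum_(p <- map f (fset_set J)) G p.1 p.2 <= _).
  rewrite big_map !big_seq; apply: ler_sum => j; rewrite in_fset_set// inE => Jj.
  by rewrite -{1}(rc j Jj) FG// rc.
rewrite -(big_allpairs (F := fun p : seq nat * nat => G p.1 p.2)).
apply: sum_subset_le => [|||p]; last exact: G0.
- rewrite map_inj_in_uniq ?fset_uniq// => j j'; rewrite !in_fset_set// !inE.
  by move=> Jj Jj' [h1 h2]; rewrite -(rc j Jj) -(rc j' Jj') h1 h2.
- by apply: allpairs_uniq => [||[? ?] [? ?] _ _ //]; rewrite ?fset_uniq ?iota_uniq.
- move=> _ /mapP[j + ->]; rewrite in_fset_set// inE => Jj.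
  have [[sj oj] nj] := JJ j Jj.
  apply/allpairsP; exists (f j); split=> //=.
    rewrite in_fset_set// inE; split; last by exists (last 0%N j); rewrite rc.
    by split; [rewrite size_take sj ltnSn|exact: take_sorted].
  rewrite mem_index_iota /=; move: nj; rewrite -{1}(rc j Jj) all_rcons.
  by case/andP.
Qed.

End Exponents.

Section Coefficients.
Variable R : realType.
Implicit Types (c : seq nat -> R[i]) (u : nat -> R[i]) (j e : seq nat).

(** By [expof_inj] the sum has at most one term; writing a sum gives the value 0 at exponents that
    come from no index. *)
Definition excoef m n c e : R[i] :=
  \sum_(j <- fset_set (Jidx_le m n) | expof n j == e) c j.

Lemma excoef_expof m n c j : Jidx_le m n j -> excoef m n c (expof n j) = c j.
Proof.
move=> Jj; have fJ := finite_Jidx_le m n; rewrite /excoef.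
have jJ : j \in fset_set (Jidx_le m n) by rewrite in_fset_set//; apply: mem_set.
rewrite big_mkcond (bigD1_seq j) ?fset_uniq//= eqxx.
rewrite big_seq_cond big1 ?addr0// => j'; rewrite in_fset_set// => /andP[/set_mem[[_ sj'] nj'] jj'].
move: Jj => [[_ sj] nj]; case: eqP => // E.
by rewrite (expof_inj sj' sj nj' nj E) eqxx in jj'.
Qed.

Lemma excoef_eq0 m n c e : ~ (exists2 j, Jidx_le m n j & expof n j = e) ->
  excoef m n c e = 0.
Proof.
move=> H; rewrite /excoef big_seq_cond big1// => j.
rewrite in_fset_set; last exact: finite_Jidx_le.
by move=> /andP[/set_mem Jj /eqP E]; case: H; exists j.
Qed.

Lemma excoef_sumn m n c e : sumn e != m -> excoef m n c e = 0.
Proof.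
move=> em; apply: excoef_eq0 => -[j [[sj _] nj] E].
by move: em; rewrite -E sumn_expof// sj eqxx.
Qed.

Lemma excoef_has m n c e : has (fun i => (m.+1 <= i)%N) e -> excoef m n c e = 0.
Proof.
move=> em; apply: excoef_eq0 => -[j Jj E].
have := expof_expo Jj (ltnSn m); rewrite mem_expo => /andP[_ /allP h].
have [i ie im] := hasP em; rewrite -E in ie.
by have := h i ie; rewrite ltnNge im.
Qed.

(** The exponents of an index of length m are at most m, hence the range [m.+1]. *)
Lemma hpoly_mpol m n c u :
  hpoly (Jidx_le m n) c u = mpol m.+1 n (excoef m n c) (mkseq u n).
Proof.
have fJ := finite_Jidx_le m n; rewrite /hpoly fsbig_finite//=.
rewrite /mpol /excoef.
under [RHS]eq_bigr do rewrite mulr_suml big_mkcond /=.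
rewrite exchange_big /= !big_seq; apply: eq_bigr => j; rewrite in_fset_set// inE => Jj.
rewrite (bigD1_seq (expof n j)) ?uniq_expo ?(expof_expo Jj)//= eqxx.
rewrite big1 ?addr0 => [|e]; last by rewrite eq_sym => /negbTE ->.
by case: Jj => _ nj; rewrite mon_expof.
Qed.

Lemma mpol_hpoly m n c (y : seq R[i]) : size y = n ->
  mpol m.+1 n (excoef m n c) y = hpoly (Jidx_le m n) c (nth 0 y).
Proof. by move=> sy; rewrite hpoly_mpol -{1}sy -sy mkseq_nth. Qed.

Lemma monomialZ m (s : R[i]) u j : Jidx m j ->
  monomial j (fun k => s * u k) = s ^+ m * monomial j u.
Proof.
move=> [<- _]; rewrite /monomial; elim: j => [|k j IH].
  by rewrite !big_nil mulr1.
by rewrite !big_cons /= IH exprS mulrACA.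
Qed.

Lemma hpolyZ m n c (s : R[i]) u :
  hpoly (Jidx_le m n) c (fun k => s * u k) = s ^+ m * hpoly (Jidx_le m n) c u.
Proof.
have fJ := finite_Jidx_le m n; rewrite /hpoly !fsbig_finite//= mulr_sumr.
rewrite !big_seq; apply: eq_bigr => j; rewrite in_fset_set// inE => -[Jj _].
by rewrite (monomialZ _ _ Jj) mulrCA.
Qed.

End Coefficients.

(** * Norms of sequences *)

Section SequenceNorms.
Variables (R : realType) (r : \bar R).
Hypothesis r1 : (1 <= r)%E.
Implicit Types (u v : nat -> R[i]).

Lemma lnorm_ge0 u : (0 <= lnorm r u)%E.
Proof. exact: Lnorm_ge0. Qed.

(** One inequality covers both scaling and monotonicity in the moduli, for finite and infinite r. *)
Lemma lnorm_le (s : R) u v : 0 < s -> (forall k, normc (u k) <= s * normc (v k)) ->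
  (lnorm r u <= s%:E * lnorm r v)%E.
Proof.
move=> s0 uv; rewrite /lnorm; case: r r1 => [p| |//] p1.
  rewrite lee_fin in p1; have p0 : 0 < p by lra.
  rewrite !Lnorm_counting//.
  have S0 w : (0 <= \sum_(0 <= k <oo) `|(normc (w k : R[i]))%:E| `^ p)%E.
    by apply: nneseries_ge0 => k _ _; apply: poweR_ge0.
  have -> : s%:E = ((s%:E `^ p) `^ p^-1)%E.
    by rewrite -poweRrM divff ?gt_eqF// poweRe1// lee_fin ltW.
  rewrite -poweRM ?poweR_ge0//.
  apply: gt0_ler_poweR; rewrite ?invr_ge0 ?(ltW p0)//.
  - rewrite in_itv /= leey andbT; exact: S0.
  - by rewrite in_itv /= leey andbT; apply: mule_ge0; [rewrite lee_fin powR_ge0|exact: S0].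
  rewrite poweR_EFin -nneseriesZl => [|k _]; last exact: poweR_ge0.
  apply: lee_nneseries => [k _ _|k _]; first exact: poweR_ge0.
  rewrite !abse_EFin !poweR_EFin -EFinM lee_fin -powRM ?(ltW s0)//.
  rewrite ge0_ler_powR ?(ltW p0) ?nnegrE ?mulr_ge0 ?(ltW s0)//.
  by rewrite !ger0_norm ?normc_ge0.
rewrite unlock /=; case: ifP => [_|_]; last by rewrite mule0.
apply/ess_supP; have := @ess_sup_ge _ _ R counting (abse \o (fun k => (normc (v k))%:E)).
apply: filterS => k /= h; apply: le_trans (lee_wpmul2l _ h); last by rewrite lee_fin ltW.
by rewrite -EFinM lee_fin !ger0_norm ?normc_ge0.
Qed.

(** A set of counting measure zero is empty, so vanishing almost everywhere is vanishing
    everywhere. *)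
Lemma lnorm_eq0 u : lnorm r u = 0%E -> forall k, u k = 0.
Proof.
move=> u0 k; have r0 : (0 < r)%E by apply: lt_le_trans r1.
have [B [_ B0 sub]] :=
  @Lnorm_eq0_eq0 _ _ R counting (fun k => (normc (u k))%:E) r (fun _ _ _ => I) r0 u0.
apply: contrapT => uk; have Bk : B k.
  by apply: sub => /= /(_ I) [] /eq0_normc.
move: B0; rewrite /= /counting; case: ifPn => // fB.
move=> /eqP; rewrite eqe pnatr_eq0 cardfs_eq0 => /eqP B0.
by move: Bk; rewrite -inE -in_fset_set ?B0 ?inE//; apply/asboolP.
Qed.

End SequenceNorms.

Lemma lnorm_fin_le1 (R : realType) (p : R) (y : seq R[i]) : 1 <= p ->
  psum p y <= 1 -> (lnorm p%:E (nth 0%R y) <= 1)%E.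
Proof.
move=> p1 y1; have p0 : 0 < p by lra.
rewrite /lnorm Lnorm_counting//.
rewrite (nneseries_split 0 (size y)) => [|k _]; last exact: poweR_ge0.
rewrite add0n [X in (_ + X)%E]eseries0 => [|k yk _]; last first.
  by rewrite nth_default// (normc0 R) abse_EFin normr0 poweR0r ?gt_eqF.
rewrite adde0 (eq_bigr (fun k => (normc (nth 0 y k) `^ p)%:E)) => [|k _]; last first.
  by rewrite abse_EFin poweR_EFin ger0_norm ?normc_ge0.
rewrite sumEFin -(big_nth 0 xpredT (fun x => normc x `^ p)) poweR_EFin lee_fin.
rewrite -[leRHS](_ : 1 `^ p^-1 = 1); last by rewrite powR1.
rewrite ge0_ler_powR ?invr_ge0 ?(ltW p0) ?nnegrE//.
by apply: sumr_ge0 => x _; exact: powR_ge0.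
Qed.

Lemma psum_le1 (R : realType) (p : R) (u : nat -> R[i]) n : 1 <= p ->
  (lnorm p%:E u <= 1)%E -> psum p (mkseq u n) <= 1.
Proof.
move=> p1; have p0 : 0 < p by lra.
rewrite /lnorm => h; rewrite -lee_fin.
have : (Lnorm counting p%:E (fun k => (normc (u k))%:E) `^ p <= 1)%E.
  rewrite -(poweR1r p); apply: gt0_ler_poweR; rewrite ?(ltW p0)//.
    by rewrite in_itv /= leey andbT Lnorm_ge0.
  by rewrite in_itv /= leey andbT lee_fin.
apply: le_trans; rewrite Lnorm_counting// -poweRrM mulVf ?gt_eqF// poweRe1; last first.
  by apply: nneseries_ge0 => k _ _; exact: poweR_ge0.
apply: le_trans (nneseries_lim_ge n _); last by move=> k _ _; exact: poweR_ge0.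
rewrite /psum big_map -sumEFin /index_iota subn0; apply: lee_sum => k _.
by rewrite abse_EFin poweR_EFin ger0_norm ?normc_ge0.
Qed.

(** * The estimate *)

Section MainEstimate.
Variables (R : realType) (r : \bar R) (m n : nat).
Hypothesis r1 : (1 <= r)%E.
Implicit Types (u : nat -> R[i]) (c : seq nat -> R[i]) (J : set (seq nat)) (S : R).

(** The degree is m + 1 here. At r = 2 the second value is taken: as 2^(m/2) <= e^(m/2), it
    satisfies both required bounds. *)
Definition mon_const : R := expR 1 * m.+1%:R *
  (if (r < 2%:E)%E then expR (m%:R / fine r) else 2 `^ (m%:R / 2)).

Lemma deriv_const_le : deriv_const R m.+1 <= expR 1 * m.+1%:R.
Proof.
rewrite /deriv_const mulrC ler_wpM2r//.
have -> : expR 1 = expR (m.+1%:R^-1) ^+ m.+1 :> R.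
  by rewrite -expRM_natl divff.
by rewrite lerXn2r ?nnegrE ?expR_ge0 ?addr_ge0 ?invr_ge0// expR_ge1Dx.
Qed.

Lemma mon_const_ge1 : 1 <= mon_const.
Proof.
have h1 : 1 <= expR 1 :> R by rewrite (le_trans _ (expR_ge1Dx 1))//; lra.
have h2 : 1 <= m.+1%:R :> R by rewrite ler1n.
rewrite /mon_const !mulr_ege1//.
case: ifP => _.
  rewrite -expR0 ler_expR divr_ge0// fine_ge0// (le_trans _ r1)//.
by rewrite -[leLHS](powRr0 (2 : R)); apply: ler_powR; rewrite ?ler1n ?divr_ge0.
Qed.

Let N J : nat := set_card (reduced m.+1 J).

Lemma monomial_mon c u j k : Jidx_le m.+1 n (rcons j k) ->
  normc (c (rcons j k)) * normc (monomial (rcons j k) u) <=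
  normc (mon (expof n j) (mkseq u n)) *
    (normc (u k) * normc (dcoef (excoef m.+1 n c) k (expof n j))).
Proof.
move=> Jjk; have [_ njk] := Jjk.
have /andP[kn nj] : (k < n)%N && all (fun k => (k < n)%N) j.
  by move: njk; rewrite all_rcons.
rewrite /dcoef -expof_rcons// excoef_expof// normcM normc_nat mon_expof//.
rewrite /monomial -cats1 big_cat big_seq1 /= normcM.
(* [q] is the integer factor, at least 1, that differentiation puts in front of the coefficient. *)
set a := normc _; set b := normc _; set x := normc _; set q := _.+1.
have ab : 0 <= a * b * x by rewrite !mulr_ge0 ?normc_ge0.
have q1 : 1 <= q%:R :> R by rewrite ler1n.
have -> : b * (x * (q%:R * a)) = q%:R * (a * b * x) by ring.
by rewrite mulrA ler_peMl.
Qed.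

(** The coefficients [a] are those of y -> P(u y). For y in the polydisc, u y is dominated by u and
    stays in the unit ball of ell_r, so the polydisc estimate applies, with u_j already contained in
    the coefficients. *)
Lemma unit_ball_large c J u S : (2%:E <= r)%E -> J `<=` Jidx_le m.+1 n ->
  (lnorm r u <= 1)%E ->
  (forall x, (lnorm r x <= 1)%E -> normc (hpoly (Jidx_le m.+1 n) c x) <= S) ->
  \sum_(j <- fset_set J) normc (c j) * normc (monomial j u) <=
  Num.sqrt (N J)%:R * (Num.sqrt 2 ^+ m * (deriv_const R m.+1 * S)).
Proof.
move=> r2 JJ u1 cS.
have fR := finite_reduced m.+1 (sub_finite_set JJ (finite_Jidx_le m.+1 n)).
pose us := mkseq u n.
pose a e := excoef m.+1 n c e * mon e us.
have aD e : has (fun i => (m.+2 <= i)%N) e -> a e = 0.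
  by move=> h; rewrite /a excoef_has ?mul0r.
have am e : sumn e != m.+1 -> a e = 0.
  by move=> h; rewrite /a excoef_sumn ?mul0r.
have aS y : size y = n -> all (fun x => normc x <= 1) y -> normc (mpol m.+2 n a y) <= S.
  move=> sy y1.
  have -> : mpol m.+2 n a y = mpol m.+2 n (excoef m.+1 n c) [seq q.1 * q.2 | q <- zip us y].
    rewrite /mpol !big_seq; apply: eq_bigr => e; rewrite mem_expo => /andP[/eqP se _].
    by rewrite mon_mul ?size_mkseq ?sy// mulrA.
  have sz : size [seq q.1 * q.2 | q <- zip us y] = n.
    by rewrite size_map size_zip size_mkseq sy minnn.
  rewrite mpol_hpoly//; apply: cS; rewrite (le_trans _ u1)// -[leRHS]mul1e.
  apply: lnorm_le => // k; rewrite mul1r.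
  have [nk|kn] := leqP n k; first by rewrite nth_default ?sz// (normc0 R) normc_ge0.
  rewrite (nth_map (0, 0)) ?size_zip ?size_mkseq ?sy ?minnn// nth_zip ?size_mkseq ?sy//=.
  rewrite nth_mkseq// normcM ler_piMr ?normc_ge0//.
  by apply: (allP y1); rewrite mem_nth ?sy.
pose X := [seq expof n j | j <- fset_set (reduced m.+1 J)].
have RJ := Jidx_le_reduced JJ.
have uX : uniq X.
  rewrite map_inj_in_uniq ?fset_uniq// => j j'; rewrite !in_fset_set//.
  move=> /set_mem/RJ[[_ sj] nj] /set_mem/RJ[[_ sj'] nj'].
  exact: expof_inj.
have XD : {subset X <= expo m.+2 n}.
  move=> _ /mapP[j + ->]; rewrite in_fset_set// => /set_mem/RJ Jj.
  by apply: expof_expo Jj _.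
have := sum_deriv_coef_le aD am aS uX XD.
rewrite {1}/X big_map size_map; apply: le_trans.
apply: (@sum_reduced_le R m n J (fun j => normc (c j) * normc (monomial j u))
  (fun j k => normc (dcoef a k (expof n j)))) => //.
  by move=> j k; exact: normc_ge0.
move=> j k /JJ Jjk; have [_ njk] := Jjk.
have kn : (k < n)%N by move: njk; rewrite all_rcons => /andP[].
rewrite /dcoef /a -expof_rcons// excoef_expof// mon_expof// !normcM normc_nat.
by rewrite ler_peMl ?mulr_ge0 ?normc_ge0// ler1n.
Qed.

(** The last factor u_k of a monomial goes into the direction of differentiation; the first m
    factors form the monomial of the reduced index. *)
Lemma unit_ball_small c J u S (p : R) : r = p%:E -> J `<=` Jidx_le m.+1 n ->
  (lnorm r u <= 1)%E ->
  (forall x, (lnorm r x <= 1)%E -> normc (hpoly (Jidx_le m.+1 n) c x) <= S) ->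
  \sum_(j <- fset_set J) normc (c j) * normc (monomial j u) <=
  (N J)%:R `^ (1 - p^-1) * expR (m%:R / p) * (deriv_const R m.+1 * S).
Proof.
move=> rp JJ u1 cS; rewrite rp in u1 cS.
have p1 : 1 <= p by rewrite -lee_fin -rp.
have fR := finite_reduced m.+1 (sub_finite_set JJ (finite_Jidx_le m.+1 n)).
have aS y : size y = n -> psum p y <= 1 -> normc (mpol m.+2 n (excoef m.+1 n c) y) <= S.
  by move=> sy y1; rewrite mpol_hpoly//; apply: cS; exact: lnorm_fin_le1.
pose X := [seq expof n j | j <- fset_set (reduced m.+1 J)].
have RJ := Jidx_le_reduced JJ.
have uX : uniq X.
  rewrite map_inj_in_uniq ?fset_uniq// => j j'; rewrite !in_fset_set//.
  move=> /set_mem/RJ[[_ sj] nj] /set_mem/RJ[[_ sj'] nj'].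
  exact: expof_inj.
have XD : {subset X <= expo m.+2 n}.
  move=> _ /mapP[j + ->]; rewrite in_fset_set// => /set_mem/RJ Jj.
  by apply: expof_expo Jj _.
have Xm e : e \in X -> sumn e = m.
  move=> /mapP[j + ->]; rewrite in_fset_set// => /set_mem/RJ[[sj _] nj].
  by rewrite sumn_expof.
have := sum_deriv_coef_small_le p1 (@excoef_has R m.+1 n c) (@excoef_sumn R m.+1 n c)
  aS (size_mkseq u n) (psum_le1 n p1 u1) uX XD Xm.
rewrite {1}/X big_map size_map; apply: le_trans.
under [leRHS]eq_bigr do rewrite mulr_sumr.
apply: (@sum_reduced_le R m n J (fun j => normc (c j) * normc (monomial j u))
  (fun j k => normc (mon (expof n j) (mkseq u n)) *
   (normc (nth 0 (mkseq u n) k) * normc (dcoef (excoef m.+1 n c) k (expof n j))))) => //.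
  by move=> j k; rewrite !mulr_ge0 ?normc_ge0.
move=> j k /JJ Jjk; rewrite nth_mkseq; first exact: monomial_mon.
by case: Jjk => _; rewrite all_rcons => /andP[].
Qed.

Lemma unit_ball_le c J u S : J `<=` Jidx_le m.+1 n -> (lnorm r u <= 1)%E ->
  (forall x, (lnorm r x <= 1)%E -> normc (hpoly (Jidx_le m.+1 n) c x) <= S) ->
  \sum_(j <- fset_set J) normc (c j) * normc (monomial j u) <=
  mon_const * (N J)%:R `^ red_exponent r * S.
Proof.
move=> JJ u1 cS; have S0 : 0 <= S := le_trans (normc_ge0 _) (cS u u1).
rewrite /mon_const /red_exponent; case: ifPn => [r2|].
  have [p rp] : exists p, r = p%:E.
    by move: r1 r2; case: (r) => // p _ _; exists p.
  rewrite min_l ?(ltW r2)//; have -> : fine r = p by rewrite rp.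
  apply: le_trans (unit_ball_small rp JJ u1 cS) _.
  rewrite [leRHS](_ : _ = (N J)%:R `^ (1 - p^-1) * expR (m%:R / p) *
    (expR 1 * m.+1%:R * S)); last by ring.
  rewrite ler_wpM2l ?mulr_ge0 ?powR_ge0 ?expR_ge0//.
  by rewrite ler_wpM2r// deriv_const_le.
rewrite -leNgt => r2; rewrite min_r//=.
apply: le_trans (unit_ball_large r2 JJ u1 cS) _.
have -> : 1 - 2^-1 = 2^-1 :> R by field.
rewrite powR12_sqrt ?ler0n//.
have -> : 2 `^ (m%:R / 2) = Num.sqrt 2 ^+ m :> R.
  by rewrite mulrC powRrM powR12_sqrt// powR_mulrn// sqrtr_ge0.
rewrite [leRHS](_ : _ = Num.sqrt (N J)%:R * (Num.sqrt 2 ^+ m *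
  (expR 1 * m.+1%:R * S))); last by ring.
rewrite ler_wpM2l ?sqrtr_ge0// ler_wpM2l ?exprn_ge0 ?sqrtr_ge0//.
by rewrite ler_wpM2r// deriv_const_le.
Qed.

(** By homogeneity P(t x) = t^(m+1) P(x), and t tends to 1 from below. *)
Lemma closed_ball_le c S :
  (forall x, (lnorm r x < 1)%E -> normc (hpoly (Jidx_le m.+1 n) c x) <= S) ->
  forall x, (lnorm r x <= 1)%E -> normc (hpoly (Jidx_le m.+1 n) c x) <= S.
Proof.
move=> cS x x1; set P := normc _; have P0 : 0 <= P := normc_ge0 _.
have bern (t : R) : 0 < t < 1 -> t ^+ m.+1 * P <= S.
  move=> /andP[t0 t1].
  have := cS (fun k => t%:C%C * x k).
  rewrite hpolyZ normcM normcX normc_real ?(ltW t0)//; apply.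
  apply: (@le_lt_trans _ _ (t%:E * lnorm r x)%E).
    by apply: lnorm_le => // k; rewrite normcM normc_real// ltW.
  apply: (@le_lt_trans _ _ (t%:E * 1)%E); last by rewrite mule1 lte_fin.
  by rewrite lee_wpmul2l// lee_fin ltW.
apply/ler_addgt0Pr => e e0.
(* With t = 1 - d, Bernoulli's inequality bounds the loss by (m + 1) d P, which is at most e. *)
pose d := Num.min 2^-1 (e / (m.+1%:R * P + 1)).
have mP : 0 <= m.+1%:R * P by rewrite mulr_ge0.
have d0 : 0 < d by rewrite lt_min invr_gt0 ltr0n divr_gt0//; lra.
have dh : d <= 2^-1 by rewrite ge_min lexx.
have de : d * (m.+1%:R * P) <= e.
  have : d <= e / (m.+1%:R * P + 1) by rewrite ge_min lexx orbT.
  by rewrite ler_pdivlMr; nra.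
have bn k : 1 - k%:R * d <= (1 - d) ^+ k.
  elim: k => [|k IH]; first by rewrite mul0r subr0.
  have : (1 - d) * (1 - k%:R * d) <= (1 - d) * (1 - d) ^+ k.
    by rewrite ler_wpM2l//; lra.
  have : 0 <= k%:R * d * d by rewrite !mulr_ge0// ltW.
  by rewrite exprS -natr1; lra.
have h1 : (1 - d) ^+ m.+1 * P <= S by apply: bern; lra.
have h2 : (1 - m.+1%:R * d) * P <= (1 - d) ^+ m.+1 * P by rewrite ler_wpM2r.
by lra.
Qed.

(** Both sides are homogeneous in u, so the estimate on the unit ball is applied to u / |u|, with
    the supremum extended from the open to the closed ball. *)
Lemma sum_coef_le P c J u : has_coefs r (Jidx_le m.+1 n) P c ->
  J `<=` Jidx_le m.+1 n -> u \in ell r ->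
  ((\sum_(j \in J) normc (c j) * normc (monomial j u))%R%:E <=
    mon_const%:E * ((N J)%:R `^ red_exponent r)%R%:E *
    lnorm r u ^+ m.+1 * supnorm r P)%E.
Proof.
move=> Pc JJ ur; have fJ := sub_finite_set JJ (finite_Jidx_le m.+1 n).
rewrite fsbig_finite//=.
have C0 : 0 < mon_const := lt_le_trans ltr01 mon_const_ge1.
have K0 : 0 <= (N J)%:R `^ red_exponent r :> R by exact: powR_ge0.
have z1 : (lnorm r (fun=> 0%R : R[i]) < 1)%E.
  have -> : lnorm r (fun=> 0%R : R[i]) = 0%E; last by rewrite lte_fin.
  rewrite /lnorm; under eq_fun do rewrite (normc0 R).
  by apply: Lnorm0; rewrite gt_eqF// (lt_le_trans _ r1).
have sup0 : (0 <= supnorm r P)%E.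
  apply: le_trans (_ : ((normc (P (fun=> 0%R)))%:E <= _)%E); last first.
    by apply: ereal_sup_ubound; exists (fun=> 0).
  by rewrite lee_fin normc_ge0.
have L0 := lnorm_ge0 r u.
have RHS0 : (0 <= mon_const%:E * ((N J)%:R `^ red_exponent r)%:E *
    lnorm r u ^+ m.+1 * supnorm r P)%E.
  by rewrite !mule_ge0 ?expe_ge0// lee_fin ltW.
(* As 0 times +oo is 0, an infinite supremum makes the right side infinite only if the other factors
   are positive; so u = 0 and empty J are set apart. *)
have [L00|Ln0] := eqVneq (lnorm r u) 0%E.
  rewrite big_seq big1// => j; rewrite in_fset_set// => /set_mem/JJ[[sj _] _].
  have u0 := lnorm_eq0 r1 L00.
  case: j sj => // k j _; rewrite /monomial big_cons u0 mul0r.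
  by rewrite (normc0 R) mulr0.
have [J0|Jn0] := eqVneq J set0.
  by rewrite big_seq big1// => j; rewrite J0 fset_set0 in_fset0.
have NJ : (0 < N J)%N.
  have [j Jj] : J !=set0 by apply/set0P.
  rewrite /N /set_card cardfs_gt0; apply/fset0Pn.
  have [[sj oj] _] := JJ j Jj.
  case/lastP: j sj Jj oj => // s k; rewrite size_rcons => -[ss] Jsk osk.
  exists s; rewrite in_fset_set; last exact: finite_reduced.
  apply/mem_set; split; last by exists k.
  split=> //; move: osk; rewrite -cats1; apply: (subseq_sorted leq_trans).
  exact: prefix_subseq.
have Kp : 0 < (N J)%:R `^ red_exponent r :> R by rewrite powR_gt0// ltr0n.
have Lfin : lnorm r u \is a fin_num.
  by rewrite ge0_fin_numE//; move: ur; rewrite inE.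
have [L LE] : exists L, lnorm r u = L%:E by exists (fine (lnorm r u)); rewrite fineK.
have Lp : 0 < L by rewrite -lte_fin -LE lt_def Ln0.
have -> : (mon_const%:E * ((N J)%:R `^ red_exponent r)%:E * lnorm r u ^+ m.+1)%E =
    (mon_const * (N J)%:R `^ red_exponent r * L ^+ m.+1)%:E by rewrite LE -EFin_expe.
have CKL : 0 < mon_const * (N J)%:R `^ red_exponent r * L ^+ m.+1.
  by apply: mulr_gt0; [exact: mulr_gt0|exact: exprn_gt0].
have [Pfin|] := boolP (supnorm r P \is a fin_num); last first.
  rewrite ge0_fin_numE// -leNgt leye_eq => /eqP ->.
  by rewrite gt0_muley ?leey// lte_fin.
rewrite -(fineK Pfin) -EFinM lee_fin; set S := fine _.
pose v k := L^-1%:C%C * u k.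
have v1 : (lnorm r v <= 1)%E.
  have -> : 1%E = (L^-1%:E * lnorm r u)%E by rewrite LE -EFinM mulVf// gt_eqF.
  apply: lnorm_le; rewrite ?invr_gt0// => k.
  by rewrite normcM normc_real// invr_ge0 ltW.
have := @unit_ball_le c J v S JJ v1.
have cS x : (lnorm r x < 1)%E -> normc (hpoly (Jidx_le m.+1 n) c x) <= S.
  move=> x1; rewrite -Pc; last by rewrite inE /ell /= (lt_trans x1) ?ltry.
  rewrite -lee_fin /S fineK//; apply: ereal_sup_ubound; by exists x.
move=> /(_ (closed_ball_le cS)).
have -> : \sum_(j <- fset_set J) normc (c j) * normc (monomial j v) =
   L ^- m.+1 * \sum_(j <- fset_set J) normc (c j) * normc (monomial j u).
  rewrite mulr_sumr !big_seq; apply: eq_bigr => j; rewrite in_fset_set//.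
  move=> /set_mem/JJ[Jj _]; rewrite (monomialZ _ _ Jj) normcM normcX.
  by rewrite normc_real ?invr_ge0 ?(ltW Lp)// exprVn mulrCA.
rewrite ler_pdivrMl ?exprn_gt0// => /le_trans; apply.
by rewrite [leRHS]mulrAC mulrC.
Qed.

End MainEstimate.

(** Unimodular multipliers do not change the sum of the moduli |c_j| |u_j|, which dominates the
    modified polynomial and is itself bounded by [sum_coef_le]. *)
Lemma chi_mon_le (R : realType) (r : \bar R) (m : nat) (J : set (seq nat)) :
  (1 <= r)%E -> finite_set J -> J `<=` Jidx m.+1 ->
  (chi_mon r J <=
    (mon_const r m * (set_card (reduced m.+1 J))%:R `^ red_exponent r)%:E)%E.
Proof.
move=> r1 fJ JJ; set b := mon_const r m * _.
have b0 : 0 <= b.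
  by rewrite mulr_ge0 ?powR_ge0// (le_trans _ (mon_const_ge1 m r1)).
apply: ereal_inf_lbound; exists b => //; split=> // c eps eps1.
have [n Jn] : exists n, J `<=` Jidx_le m.+1 n.
  exists (\max_(j <- fset_set J) (\max_(k <- j) k)).+1 => j Jj.
  split; first exact: JJ.
  apply/allP => k kj; rewrite ltnS (@leq_trans (\max_(k <- j) k))//.
    exact: leq_bigmax_seq.
  apply: (@leq_bigmax_seq _ _ xpredT (fun j => \max_(k <- j) k)) => //.
  by rewrite in_fset_set//; exact/mem_set.
(* Extension by zero makes the polynomial an element of the full space over [Jidx_le m.+1 n]. *)
pose c' j := if `[< J j >] then c j else 0.
have hE u : hpoly J c u = hpoly (Jidx_le m.+1 n) c' u.
  rewrite /hpoly (fsbigID J (Jidx_le m.+1 n))/=; last exact: finite_Jidx_le.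
  rewrite setIidr// [X in _ + X]fsbig1 ?addr0 => [|j [_ nJj]]; last first.
    by rewrite /c' asboolF ?mul0r.
  by apply: eq_fsbigr => j /set_mem Jj; rewrite /c' asboolT.
have hc : has_coefs r (Jidx_le m.+1 n) (hpoly J c) c' by move=> u _; exact: hE.
apply: ge_ereal_sup => _ [u /= u1 <-].
have ur : u \in ell r by rewrite inE /ell /= (lt_trans u1) ?ltry.
apply: le_trans (_ : ((\sum_(j \in J) normc (c' j) * normc (monomial j u))%R%:E <= _)%E).
  rewrite lee_fin /hpoly !fsbig_finite//= (le_trans (normc_sum _ _ _))//.
  rewrite !big_seq; apply: ler_sum => j; rewrite in_fset_set// => /set_mem Jj.
  by rewrite /c' asboolT// !normcM eps1// mul1r.
apply: le_trans (sum_coef_le r1 hc Jn ur) _.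
have sup0 : (0 <= supnorm r (hpoly J c))%E.
  apply: le_trans (_ : ((normc (hpoly J c u))%:E <= _)%E); last first.
    by apply: ereal_sup_ubound; exists u.
  by rewrite lee_fin normc_ge0.
rewrite -EFinM; apply: lee_wpmul2r => //.
rewrite -[leRHS]mule1 lee_wpmul2l ?lee_fin//.
have Lf : lnorm r u \is a fin_num.
  by rewrite ge0_fin_numE ?lnorm_ge0// (lt_trans u1) ?ltry.
rewrite -(fineK Lf) -EFin_expe lee_fin exprn_ile1 ?fine_ge0 ?lnorm_ge0//.
by rewrite -lee_fin fineK// ltW.
Qed.

Theorem theorem3p2 (R : realType) (r : \bar R) (m : nat)
    (hr : (1 <= r)%E) (hm : (1 <= m)%N) :
  exists C : R,
    [/\ 1 <= C,
        ((r <= 2%:E)%E -> C <= expR 1 * m%:R * expR (m.-1%:R / fine r)),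
        ((2%:E <= r)%E -> C <= expR 1 * m%:R * (2 `^ (m.-1%:R / 2))),
        (forall (n : nat) (P : (nat -> R[i]) -> R[i]) (c : seq nat -> R[i])
            (J : set (seq nat)) (u : nat -> R[i]),
          (1 <= n)%N -> has_coefs r (Jidx_le m n) P c ->
          J `<=` Jidx_le m n -> u \in ell r ->
          ((\sum_(j \in J) normc (c j) * normc (monomial j u))%R%:E
            <= C%:E * ((set_card (reduced m J))%:R `^ red_exponent r)%R%:E
               * lnorm r u ^+ m * supnorm r P)%E) &
        (forall J : set (seq nat), finite_set J -> J `<=` Jidx m ->
          (chi_mon r J
            <= (C * (set_card (reduced m J))%:R `^ red_exponent r)%:E)%E)].
Proof.
case: m hm => // m _ /=; exists (mon_const r m); split.
- exact: mon_const_ge1.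
- rewrite le_eqVlt => /predU1P[->|r2]; rewrite /mon_const ?ltxx/= ?r2//.
  (* At r = 2 the bound reduces to 2 <= e, raised to the power m/2. *)
  rewrite ler_wpM2l ?mulr_ge0 ?expR_ge0//.
  rewrite -[X in expR X]mul1r expRM ge0_ler_powR ?nnegrE ?expR_ge0 ?divr_ge0//.
  exact: expR_ge1Dx.
- by move=> r2; rewrite /mon_const ltNge r2.
- by move=> n P c J u _; exact: sum_coef_le.
- by move=> J; exact: chi_mon_le.
Qed.
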